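(* $X_{\mathrm{sub}}$ is singular at every point $(\Phi,0)$ which has more than one pre-image in $\widetilde X_{\mathrm{sub}}$ under the morphism $\widetilde X_{\mathrm{sub}}\to X_{\varphi,N}$, $(P,\Phi,N)\mapsto(\Phi,N)$.
   Context: $p$ prime, $E/\mathbb{Q}_p$ finite, everything over $\overline E$; $G=\mathrm{GL}_3$. $X_{\varphi,N}$ is the closed subscheme of $\mathrm{GL}_3\times\mathfrak{gl}_3$ of pairs $(\Phi,N)$ with $N=p\,\mathrm{Ad}(\Phi)(N)$. $X_{\mathrm{sub}}$ is the closure (reduced) in $X_{\varphi,N}$ of the locus where $N$ is subregular nilpotent (conjugate to $E_{12}$). $P_{\mathrm{sub}}$ is the parabolic of invertible matrices with vanishing $(2,1)$, $(2,3)$, $(3,1)$ entries, $\mathfrak{g}_2$ the line spanned by $E_{12}$, and for $P=gP_{\mathrm{sub}}g^{-1}$, $\mathfrak{p}_2=\mathrm{Ad}(g)\mathfrak{g}_2$. $\widetilde X_{\mathrm{sub}}(A)$ is the set of $(P,\Phi,N)$ with $P\in(G/P_{\mathrm{sub}})(A)$, $\Phi\in P(A)$, $N\in\mathfrak{p}_2(A)$, and $1-p\,\mathrm{Ad}(\Phi)$ vanishing on $\mathfrak{p}_2$. *)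

(* Defs.v *)
From HB Require Import structures.
From mathcomp Require Import all_boot all_order all_algebra all_field.
From mathcomp Require Import generic_quotient ring_quotient.
From mathcomp Require Import boolp classical_sets.
From mathcomp Require Import ring.
From mathcomp Require Import mpoly.

Set Implicit Arguments.
Unset Strict Implicit.
Unset Printing Implicit Defensive.

Import Order.TTheory GRing.Theory Num.Theory.
Local Open Scope classical_set_scope.
Local Open Scope ring_scope.
Local Open Scope quotient_scope.

(* The field Q_p, as the completion of Q for the p-adic absolute value: a field
   containing Q as a dense subset, complete for a nonarchimedean absolute value
   normalised by |p| = 1/p.  On Q such an absolute value can only be the p-adic
   one, so this determines (F, abs) up to unique isomorphism.  The values of
   the absolute value are 0 and powers of p, hence rational. *)
Record padic_field (p : nat) (F : fieldType) (abs : F -> rat) : Prop := {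
  padic_abs_ge0 : forall x, 0 <= abs x;
  padic_abs_eq0 : forall x, abs x = 0 <-> x = 0;
  padic_absM : forall x y, abs (x * y) = abs x * abs y;
  padic_absD : forall x y, abs (x + y) <= Num.max (abs x) (abs y);
  padic_abs_p : abs p%:R = p%:R^-1;
  padic_dense : forall x (e : rat), 0 < e ->
    exists q : rat, abs (x - ratr q) < e;
  padic_complete : forall u : nat -> F,
    (forall e : rat, 0 < e -> exists n0, forall m n,
       (n0 <= m)%N -> (n0 <= n)%N -> abs (u m - u n) < e) ->
    exists l, forall e : rat, 0 < e -> exists n0, forall n,
       (n0 <= n)%N -> abs (u n - l) < e
}.

Section RegularLocalRings.
Variable R : comNzRingType.
Implicit Types (I J P m : {pred R}) (s : seq R).

(* In MathComp idealr_closed already includes 1 \notin I. *)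
Definition prime_ideal P := idealr_closed P /\ prime_idealr_closed P.

Definition maximal_ideal m :=
  idealr_closed m /\
  forall J, idealr_closed J -> {subset m <= J} -> J =i m.

Definition generated_by s I := forall a : R,
  a \in I <-> exists c : 'I_(size s) -> R, a = \sum_i c i * s`_i.

Definition noetherian :=
  forall I, idealr_closed I -> exists s, generated_by s I.

Definition prime_chain (d : nat) (C : nat -> {pred R}) :=
  (forall i, (i <= d)%N -> prime_ideal (C i)) /\
  (forall i, (i < d)%N ->
     {subset C i <= C i.+1} /\ ~ {subset C i.+1 <= C i}).

Definition krull_dim (d : nat) :=
  (exists C, prime_chain d C) /\
  forall e, (exists C, prime_chain e C) -> (e <= d)%N.

Definition regular_local_ring :=
  noetherian /\
  exists m, [/\ maximal_ideal m,
    (forall m', maximal_ideal m' -> m' =i m) &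
    exists2 s, generated_by s m & krull_dim (size s)].

End RegularLocalRings.

(* The local ring at a point x of a reduced, locally closed X in affine n-space
   over an algebraically closed field (X being given by its set of rational
   points): the localisation at x of K[X_1..X_n]/I(X), that is, the fractions
   f / g with g x != 0, where f / g = f' / g' if and only if
   h (f g' - f' g) vanishes on X for some h with h x != 0. *)
Section Germs.
Variables (K : fieldType) (n : nat) (X : set ('I_n -> K)) (x : 'I_n -> K).

Definition fracs := {f : {mpoly K[n]} * {mpoly K[n]} | f.2.@[x] != 0}.

Definition frac (f g : {mpoly K[n]}) (gx : g.@[x] != 0) : fracs :=
  exist _ (f, g) gx.

Definition num (a : fracs) := (val a).1.
Definition den (a : fracs) := (val a).2.

Lemma den_neq0 a : (den a).@[x] != 0. Proof. exact: (valP a). Qed.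

Lemma denM_neq0 a b : (den a * den b).@[x] != 0.
Proof. by rewrite mevalM mulf_neq0 ?den_neq0. Qed.

Lemma den1_neq0 : (1 : {mpoly K[n]}).@[x] != 0.
Proof. by rewrite meval1 oner_eq0. Qed.

Definition germ_eq (a b : fracs) : bool :=
  `[< exists2 h : {mpoly K[n]}, h.@[x] != 0 &
      forall y, X y -> (h * (num a * den b - num b * den a)).@[y] = 0 >].

Lemma germ_eq_refl : reflexive germ_eq.
Proof.
move=> a; apply/asboolP; exists 1; first exact: den1_neq0.
by move=> y _; rewrite subrr mulr0 meval0.
Qed.

Lemma germ_eq_sym : ssrbool.symmetric germ_eq.
Proof.
suff sub a b : germ_eq a b -> germ_eq b a by move=> a b; apply/idP/idP; apply: sub.
move=> /asboolP[h hx hX]; apply/asboolP; exists h => // y /hX.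
by rewrite -opprB mulrN mevalN => /eqP; rewrite oppr_eq0 => /eqP.
Qed.

Lemma germ_eq_trans : transitive germ_eq.
Proof.
move=> b a c /asboolP[h hx hX] /asboolP[k kx kX]; apply/asboolP.
exists (h * k * den b); first by rewrite !mevalM !mulf_neq0 ?den_neq0.
move=> y Xy; have := hX y Xy; have := kX y Xy.
rewrite !(mevalM, mevalB) => E1 E2.
pose E3 := congr2 (fun s t => k.@[y] * (den c).@[y] * s
  + h.@[y] * (den a).@[y] * t) E2 E1.
by move: E3 => /=; rewrite !mulr0 addr0 => <-; ring.
Qed.

Canonical germ_eq_equiv :=
  EquivRel germ_eq germ_eq_refl germ_eq_sym germ_eq_trans.

Definition germ := {eq_quot germ_eq}.
HB.instance Definition _ : EqQuotient _ germ_eq germ := EqQuotient.on germ.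
HB.instance Definition _ := Choice.on germ.

Definition add_frac a b :=
  frac (num a * den b + num b * den a) (denM_neq0 a b).
Definition opp_frac a := frac (- num a) (den_neq0 a).
Definition mul_frac a b := frac (num a * num b) (denM_neq0 a b).

Definition germ0 : germ := lift_cst germ (frac 0 den1_neq0).
Definition germ1 : germ := lift_cst germ (frac 1 den1_neq0).
Definition germ_add := lift_op2 germ add_frac.
Definition germ_opp := lift_op1 germ opp_frac.
Definition germ_mul := lift_op2 germ mul_frac.

Canonical pi_germ0_morph := PiConst germ0.
Canonical pi_germ1_morph := PiConst germ1.

Lemma germ_eqP (a b : fracs) :
  (exists2 h : {mpoly K[n]}, h.@[x] != 0 & forall y, X y ->
     h.@[y] * ((num a).@[y] * (den b).@[y] - (num b).@[y] * (den a).@[y]) = 0)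
  <-> \pi_germ a = \pi_germ b.
Proof.
split.
  case=> h hx hX; apply/eqmodP/asboolP; exists h => // y /hX.
  by rewrite !(mevalM, mevalB).
move=> /eqmodP/asboolP[h hx hX]; exists h => // y /hX.
by rewrite !(mevalM, mevalB).
Qed.

Lemma pi_germ_add : {morph \pi_germ : a b / add_frac a b >-> germ_add a b}.
Proof.
move=> a b; unlock germ_add; apply/germ_eqP.
have /germ_eqP[h hx hX] := esym (reprK (\pi_germ a)).
have /germ_eqP[k kx kX] := esym (reprK (\pi_germ b)).
move: (repr _) (repr _) hX kX => b' a' hX kX.
exists (h * k); first by rewrite mevalM mulf_neq0.
move=> y Xy; have := congr2 (fun s t =>
    k.@[y] * (den b).@[y] * (den b').@[y] * s +
    h.@[y] * (den a).@[y] * (den a').@[y] * t) (hX y Xy) (kX y Xy).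
rewrite !mulr0 addr0 => <-.
by rewrite /add_frac /frac /num /den /= !(mevalM, mevalD); ring.
Qed.
Canonical pi_germ_add_morph := PiMorph2 pi_germ_add.

Lemma pi_germ_opp : {morph \pi_germ : a / opp_frac a >-> germ_opp a}.
Proof.
move=> a; unlock germ_opp; apply/germ_eqP.
have /germ_eqP[h hx hX] := esym (reprK (\pi_germ a)).
move: (repr _) hX => a' hX; exists h => // y /hX /(congr1 -%R).
rewrite oppr0 => <-.
by rewrite /opp_frac /frac /num /den /= !mevalN; ring.
Qed.
Canonical pi_germ_opp_morph := PiMorph1 pi_germ_opp.

Lemma pi_germ_mul : {morph \pi_germ : a b / mul_frac a b >-> germ_mul a b}.
Proof.
move=> a b; unlock germ_mul; apply/germ_eqP.
have /germ_eqP[h hx hX] := esym (reprK (\pi_germ a)).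
have /germ_eqP[k kx kX] := esym (reprK (\pi_germ b)).
move: (repr _) (repr _) hX kX => b' a' hX kX.
exists (h * k); first by rewrite mevalM mulf_neq0.
move=> y Xy; have := congr2 (fun s t =>
    k.@[y] * (num b).@[y] * (den b').@[y] * s +
    h.@[y] * (den a).@[y] * (num a').@[y] * t) (hX y Xy) (kX y Xy).
rewrite !mulr0 addr0 => <-.
by rewrite /mul_frac /frac /num /den /= !mevalM; ring.
Qed.
Canonical pi_germ_mul_morph := PiMorph2 pi_germ_mul.

Lemma germ_eq_cross (a b : fracs) :
  num a * den b = num b * den a -> \pi_germ a = \pi_germ b.
Proof.
move=> ab; apply/germ_eqP; exists 1; first exact: den1_neq0.
by move=> y _; rewrite -!mevalM ab subrr mulr0.
Qed.

Fact germ_addA : associative germ_add.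
Proof.
elim/quotW=> a; elim/quotW=> b; elim/quotW=> c; rewrite !piE.
by apply: germ_eq_cross; rewrite /add_frac /frac /num /den /=; ring.
Qed.

Fact germ_addC : commutative germ_add.
Proof.
elim/quotW=> a; elim/quotW=> b; rewrite !piE.
by apply: germ_eq_cross; rewrite /add_frac /frac /num /den /=; ring.
Qed.

Fact germ_add0 : left_id germ0 germ_add.
Proof.
elim/quotW=> a; rewrite !piE.
by apply: germ_eq_cross; rewrite /add_frac /frac /num /den /=; ring.
Qed.

Fact germ_addN : left_inverse germ0 germ_opp germ_add.
Proof.
elim/quotW=> a; rewrite !piE; apply: germ_eq_cross.
by rewrite /add_frac /opp_frac /frac /num /den /=; ring.
Qed.

HB.instance Definition _ :=
  GRing.isZmodule.Build germ germ_addA germ_addC germ_add0 germ_addN.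

Fact germ_mulA : associative germ_mul.
Proof.
elim/quotW=> a; elim/quotW=> b; elim/quotW=> c; rewrite !piE.
by apply: germ_eq_cross; rewrite /mul_frac /frac /num /den /=; ring.
Qed.

Fact germ_mulC : commutative germ_mul.
Proof.
elim/quotW=> a; elim/quotW=> b; rewrite !piE.
by apply: germ_eq_cross; rewrite /mul_frac /frac /num /den /=; ring.
Qed.

Fact germ_mul1 : left_id germ1 germ_mul.
Proof.
elim/quotW=> a; rewrite !piE.
by apply: germ_eq_cross; rewrite /mul_frac /frac /num /den /=; ring.
Qed.

Fact germ_mulDl : left_distributive germ_mul germ_add.
Proof.
elim/quotW=> a; elim/quotW=> b; elim/quotW=> c; rewrite !piE.
apply: germ_eq_cross.
by rewrite /mul_frac /add_frac /frac /num /den /=; ring.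
Qed.

HB.instance Definition _ := GRing.Zmodule_isComPzRing.Build germ
  germ_mulA germ_mulC germ_mul1 germ_mulDl.

Definition local_ring of X x : Type := germ.

Variable Xx : X x.

HB.instance Definition _ := GRing.ComPzRing.on (local_ring Xx).

Fact local_ring_nontrivial : (1 : local_ring Xx) != 0.
Proof.
apply/eqP => /=; rewrite !piE => /germ_eqP[h hx /(_ x Xx)].
rewrite /frac /num /den /= meval1 meval0 mul0r subr0 !mulr1 => h0.
by rewrite h0 eqxx in hx.
Qed.

HB.instance Definition _ :=
  GRing.PzSemiRing_isNonZero.Build (local_ring Xx) local_ring_nontrivial.

End Germs.

Definition singular_at (K : fieldType) (n : nat) (X : set ('I_n -> K))
    (x : 'I_n -> K) :=
  exists Xx : X x, ~ regular_local_ring (local_ring Xx).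

(* K-points of the Zariski closure of Y in affine space. *)
Definition zariski_closure (K : fieldType) (n : nat) (Y : set ('I_n -> K)) :
    set ('I_n -> K) :=
  [set y | forall f : {mpoly K[n]}, (forall z, Y z -> f.@[z] = 0) -> f.@[y] = 0].

(* Over an algebraically closed field K the reduced scheme X_sub, and the fibres
   of points of the map from X~_sub, are described by K-points. *)
Section PhiNModules.
Variables (K : fieldType) (p : nat).
Local Notation M := 'M[K]_3.

Definition Ad (g h : M) : M := g *m h *m invmx g.

Definition X_phiN : set (M * M) :=
  [set x | x.1 \in unitmx /\ x.2 = p%:R *: Ad x.1 x.2].

(* Rows and columns are numbered from 0. *)
Definition E12 : M := delta_mx 0 1.

Definition subregular_locus : set (M * M) :=
  [set x | X_phiN x /\ exists2 g : M, g \in unitmx & x.2 = Ad g E12].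

(* GL_3 x gl_3 as a locally closed subset of affine 18-space. *)
Definition coords (x : M * M) : 'I_(3 * 3 + 3 * 3) -> K :=
  fun k => row_mx (mxvec x.1) (mxvec x.2) 0 k.

Definition X_sub : set (M * M) :=
  [set x | X_phiN x /\
     zariski_closure (coords @` subregular_locus) (coords x)].

Definition P_sub : set M :=
  [set g | [/\ g \in unitmx, g 1 0 = 0, g 1 2 = 0 & g 2 0 = 0]].

Definition g2 : set M := [set h | exists a : K, h = a *: E12].

(* The points of G / P_sub, as the conjugates of P_sub. *)
Definition flag_variety : set (set M) :=
  [set P | exists2 g : M, g \in unitmx & P = Ad g @` P_sub].

(* Any g with P = g P_sub g^-1 gives the same line, since P_sub is its own
   normaliser and preserves g2. *)
Definition p2 (P : set M) : set M :=
  [set h | exists g : M,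
     [/\ g \in unitmx, P = Ad g @` P_sub & (Ad g @` g2) h]].

Definition Xt_sub : set (set M * M * M) :=
  [set y | let: (P, Phi, N) := y in
     [/\ flag_variety P, P Phi, p2 P N &
         forall h, p2 P h -> h - p%:R *: Ad Phi h = 0]].

Definition Xt_sub_proj (y : set M * M * M) : M * M := (y.1.2, y.2).

End PhiNModules.

Arguments coords {K} x k.

(* Main.v *)
(* A point of the fibre over (Phi, 0) is a flag, line in plane, preserved by Phi, on
   which the eigenvalues of Phi on the quotient by the plane and on the line have
   ratio p.  The curves in X_sub through (Phi, 0) that deform Phi along one such flag
   span a space of tangent vectors (Psi, 0) whose annihilator under the trace form
   consists of matrices C compatible with that flag and with Phi.  If there are two
   flags, then C = 0, so that all the (Psi, 0) are tangent; together with (0, N) for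
   one nonzero N in p_2 this makes the tangent space at least 10-dimensional.
   On the other hand X_sub is covered by images of affine 9-space, so any ten
   germs are algebraically dependent, whereas a chain of primes of length d in the
   local ring provides d algebraically independent germs; hence its dimension is at
   most 9. *)
Require Import Defs.
From HB Require Import structures.
From mathcomp Require Import all_boot all_order all_algebra all_field.
From mathcomp Require Import fingroup perm.
From mathcomp Require Import generic_quotient ring_quotient.
From mathcomp Require Import boolp classical_sets.
From mathcomp Require Import ring zify.
From mathcomp Require Import mpoly.

(* fraction.v also defines [frac]. *)
Import Defs.

Set Implicit Arguments.
Unset Strict Implicit.
Unset Printing Implicit Defensive.

Import Order.TTheory GRing.Theory Num.Theory.
Local Open Scope classical_set_scope.
Local Open Scope ring_scope.
Local Open Scope quotient_scope.

(** * Linear algebra over a field, and zeros of polynomials *)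

Lemma linear_dependence (K : fieldType) (I J : finType) (A : I -> J -> K) :
  (#|J| < #|I|)%N ->
  exists2 c : I -> K, (exists i, c i != 0) &
    forall j, \sum_i c i * A i j = 0.
Proof.
move=> JI; pose M := \matrix_(i < #|I|, j < #|J|) A (enum_val i) (enum_val j).
have kerM : kermx M != 0.
  rewrite kermx_eq0 /row_free neq_ltn (leq_ltn_trans (rank_leq_col M)) //.
have [i [k kik]] : exists i k, kermx M i k != 0.
  apply: contrapT => H; case/eqP: kerM; apply/matrixP => i k; rewrite [RHS]mxE.
  by apply: contrapT => /eqP ik0; apply: H; exists i, k.
exists (fun x => kermx M i (enum_rank x)); first by exists (enum_val k); rewrite enum_valK.
move=> j; have /matrixP/(_ i (enum_rank j)) := mulmx_ker M; rewrite !mxE => E0; rewrite -[RHS]E0.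
rewrite (reindex (@enum_val I I)); last exact/onW_bij/enum_val_bij.
by apply: eq_bigr => l _; rewrite enum_valK !mxE enum_rankK.
Qed.

(** If the family did not have full rank, a nonzero functional would kill all of it. *)
Lemma span_of_annihilator (K : fieldType) (I J : finType) (u : I -> J -> K) :
  (forall c : J -> K, (forall i, \sum_j c j * u i j = 0) -> forall j, c j = 0) ->
  forall w : J -> K, exists b : I -> K, forall j, w j = \sum_i b i * u i j.
Proof.
move=> ann w.
pose M := \matrix_(i < #|I|, j < #|J|) u (enum_val i) (enum_val j).
have fullM : row_full M.
  rewrite -col_leq_rank leqNgt; apply/negP => ltM.
  have kerM : kermx M^T != 0.
    by rewrite kermx_eq0 /row_free neq_ltn mxrank_tr ltM.
  case/eqP: kerM; apply/matrixP => i k; rewrite [RHS]mxE.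
  rewrite -(enum_valK k); apply: (ann (fun x => kermx M^T i (enum_rank x))) => l.
  have /matrixP/(_ i (enum_rank l)) := mulmx_ker M^T; rewrite !mxE => E0; rewrite -[RHS]E0.
  rewrite (reindex (@enum_val J J)); last exact/onW_bij/enum_val_bij.
  by apply: eq_bigr => q _; rewrite enum_valK !mxE enum_rankK.
have /submxP[b wb] : (\row_j w (enum_val j) <= M)%MS by rewrite submx_full.
exists (fun i => b 0 (enum_rank i)) => j.
have /matrixP/(_ 0 (enum_rank j)) := wb; rewrite !mxE enum_rankK => ->.
rewrite [RHS](reindex (@enum_val I I)); last exact/onW_bij/enum_val_bij.
by apply: eq_bigr => q _; rewrite enum_valK !mxE enum_rankK.
Qed.

(** If [q] were nonzero, so would be [q * r], which over an algebraically closed field has a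
    non-root. The factor [r] lets a curve leave out finitely many parameters. *)
Lemma poly_eq0_closed (K : closedFieldType) (r q : {poly K}) :
  r != 0 -> (forall s, r.[s] != 0 -> q.[s] = 0) -> q = 0.
Proof.
move=> r0 rq; apply/eqP; apply: contraT => q0.
have /closed_nonrootP[s] : q * r != 0 by rewrite mulf_neq0.
rewrite rootM negb_or => /andP[qs rs].
by move: qs; rewrite /root rq ?eqxx.
Qed.

(** * Algebraic independence from chains of primes *)

(** Exponent vectors with entries below [D], as nested pairs so that an induction along a chain of
    primes can split off the first variable. *)
Fixpoint exponents (e D : nat) : finType :=
  if e is e'.+1 then ('I_D * exponents e' D)%type else unit.

Fixpoint monomial (R : comNzRingType) (D e : nat) (f : nat -> R) :
    exponents e D -> R :=
  if e is e'.+1 then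
    fun m => f 0 ^+ (m : 'I_D * exponents e' D).1 * monomial (f \o S) m.2
  else fun=> 1.

Lemma card_exponents e D : #|exponents e D| = (D ^ e)%N.
Proof. by elim: e => [|e IH] /=; rewrite ?card_unit // card_prod card_ord IH expnS. Qed.

Section PrimeChains.
Variable R : comNzRingType.
Implicit Types (P Q : {pred R}) (C : nat -> {pred R}).

Lemma ideal0 P : idealr_closed P -> 0 \in P. Proof. by case. Qed.

Lemma idealD P u v : idealr_closed P -> u \in P -> v \in P -> u + v \in P.
Proof. by move=> [_ _ H] uP vP; rewrite -[u]mul1r H. Qed.

Lemma idealM P a u : idealr_closed P -> u \in P -> a * u \in P.
Proof. by move=> [P0 _ H] uP; rewrite -[_ * _]addr0 H. Qed.

Lemma idealDr P u v : idealr_closed P -> v \in P -> u + v \in P -> u \in P.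
Proof.
move=> idP vP uvP; rewrite -(addrK v u) -mulN1r; apply: idealD => //.
exact: idealM.
Qed.

(** Since [f] lies in [Q], so does the constant term [q 0], which therefore vanishes. What remains
    is [f] times a shorter sum of the same kind, and [f] cancels modulo the prime [P]. *)
Lemma prime_horner_eq0 P Q f D (q : nat -> R) :
  prime_ideal P -> idealr_closed Q -> {subset P <= Q} ->
  f \in Q -> f \notin P ->
  (forall j, (j < D)%N -> q j \in Q -> q j = 0) ->
  \sum_(j < D) f ^+ j * q j \in P -> forall j, (j < D)%N -> q j = 0.
Proof.
move=> [idP primeP] idQ PQ fQ fP; elim: D q => [|D IH] q qQ // sumP.
move: sumP; rewrite big_ord_recl /= expr0 mul1r.
rewrite (eq_bigr (fun i : 'I_D => f * (f ^+ i * q i.+1))); last first.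
  by move=> i _; rewrite /bump /= add1n exprS mulrA.
rewrite -mulr_sumr => sumP.
have q0 : q 0 = 0.
  apply: qQ => //; apply: (@idealDr Q _ _ idQ _ (PQ _ sumP)).
  by rewrite mulrC; apply: idealM.
move: sumP; rewrite q0 add0r => /primeP/orP[|sumP]; first by rewrite (negPf fP).
case=> [|j] // jD; apply: (IH (q \o S)) => // i iD; exact: qQ.
Qed.

(* Take f_i in C_i but not in C_(i-1): a relation between them modulo C_0 may be
   divided by f_1, and then reduced modulo C_1. *)
Lemma chain_independent (K : nzRingType) (k : K -> R) (e : nat) C :
  k 0 = 0 -> (forall P c, idealr_closed P -> k c \in P -> c = 0) ->
  prime_chain e C ->
  exists f : nat -> R, forall D (c : exponents e D -> K),
    \sum_m k (c m) * monomial f m \in C 0 -> forall m, c m = 0.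
Proof.
move=> k0 kP; elim: e C => [|e IH] C [primeC ltC].
  exists (fun=> 0) => D c; rewrite (bigD1 tt) //= big_pred0 => [|[] //].
  rewrite addr0 mulr1 => cC [].
  by apply: kP cC; case: (primeC 0%N isT).
have [|f' f'P] := IH (C \o S).
  by split=> i ie; [apply: primeC | apply: ltC].
have [sub01 nsub10] := ltC 0%N isT.
have [f0 fC1 fC0] : exists2 f0, f0 \in C 1 & f0 \notin C 0.
  apply: contrapT => H; apply: nsub10 => x xC1.
  by apply: contraT => xC0; case: H; exists x.
exists (fun i => if i is j.+1 then f' j else f0) => D c sumC m.
(* The coefficient of [f0 ^+ j], itself a combination of monomials in [f']; the value 0 for [j >= D]
   makes [q] total. *)
pose q (j : nat) := if insub j is Some i then
  \sum_m k (c (i : 'I_D, m)) * monomial f' m else 0.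
have qE (i : 'I_D) : q i = \sum_m k (c (i, m)) * monomial f' m.
  by rewrite /q valK.
have q0 (i : 'I_D) : q i \in C 1 -> forall m, c (i, m) = 0.
  by rewrite qE => /(f'P _ (fun m => c (i, m))).
suff H : forall j, (j < D)%N -> q j = 0.
  case: m => i m; apply: q0; rewrite H //; apply: ideal0.
  by case: (primeC 1%N isT).
apply: (@prime_horner_eq0 (C 0%N) (C 1%N) f0) => //.
- exact: primeC.
- by case: (primeC 1%N isT).
- move=> j jD; rewrite -[j]/(nat_of_ord (Ordinal jD)) => qC.
  rewrite qE big1 // => m' _.
  by rewrite q0 // k0 mul0r.
rewrite (eq_bigr (fun j : 'I_D => \sum_m'
    k (c (j, m')) * (f0 ^+ j * monomial f' m'))).
  by rewrite pair_bigA /=; move: sumC; congr (_ \in C 0%N); apply: eq_bigr => -[].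
by move=> j _; rewrite qE mulr_sumr; apply: eq_bigr => m' _; rewrite mulrCA.
Qed.

End PrimeChains.

(** * Tangent vectors *)

Lemma mpoly_alg_ind (K : comNzRingType) n (P : {mpoly K[n]} -> Prop) :
  (forall c, P c%:MP) -> (forall i, P 'X_i) ->
  (forall f g, P f -> P g -> P (f + g)) ->
  (forall f g, P f -> P g -> P (f * g)) -> forall f, P f.
Proof.
move=> PC PX PD PM; elim/mpolyind => [|c m f _ _ Pf]; first by rewrite -mpolyC0.
apply: (PD) => //; rewrite -mul_mpolyC; apply: (PM) => //; rewrite mpolyXE_id.
apply: (big_ind P) => [|f1 f2|i _]; [by rewrite -mpolyC1 | exact: PM |].
elim: (m i) => [|d IH]; first by rewrite expr0 -mpolyC1.
by rewrite exprS; apply: PM.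
Qed.

Section DirectionalDerivative.
Variables (K : comNzRingType) (n : nat).
Implicit Types (v w x : 'I_n -> K) (f g : {mpoly K[n]}).

Definition dirderiv v x f := \sum_i v i * (f^`M(i)).@[x].

Lemma dirderivC v x c : dirderiv v x c%:MP = 0.
Proof. by apply: big1 => i _; rewrite mderivC meval0 mulr0. Qed.

Lemma dirderivX v x i : dirderiv v x 'X_i = v i.
Proof.
rewrite /dirderiv (bigD1 i) //= big1 => [|j ji].
  have -> : ('X_i : {mpoly K[n]})^`M(i) = 1.
    rewrite mderivX mnm1E eqxx scale1r -mpolyX0; congr 'X_[_].
    by apply/mnmP => k; rewrite mnmBE subnn mnm0E.
  by rewrite meval1 mulr1 addr0.
by rewrite mderivX mnm1E eq_sym (negPf ji) scale0r meval0 mulr0.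
Qed.

Lemma dirderivD v x f g : dirderiv v x (f + g) = dirderiv v x f + dirderiv v x g.
Proof.
by rewrite -big_split; apply: eq_bigr => i _; rewrite mderivD mevalD mulrDr.
Qed.

Lemma dirderivN v x f : dirderiv v x (- f) = - dirderiv v x f.
Proof.
by rewrite -sumrN; apply: eq_bigr => i _; rewrite mderivN mevalN mulrN.
Qed.

Lemma dirderivM v x f g : dirderiv v x (f * g) =
  dirderiv v x f * g.@[x] + f.@[x] * dirderiv v x g.
Proof.
rewrite /dirderiv mulr_suml mulr_sumr -big_split; apply: eq_bigr => i _ /=.
by rewrite mderivM mevalD !mevalM; ring.
Qed.

Lemma dirderiv_sum (I : finType) (b : I -> K) (u : I -> 'I_n -> K) x f :
  dirderiv (fun j => \sum_i b i * u i j) x f = \sum_i b i * dirderiv (u i) x f.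
Proof.
rewrite /dirderiv; under eq_bigr => j _ do rewrite mulr_suml.
rewrite exchange_big; apply: eq_bigr => i _; rewrite mulr_sumr.
by apply: eq_bigr => j _; rewrite mulrA.
Qed.

(** Curves of degree two serve below because conjugation by [1 + s B] with [B B = 0] is quadratic in
    [s]. *)
Lemma dirderiv_curve v w x f : exists q : {poly K},
  [/\ forall s, q.[s] = f.@[fun i => x i + s * v i + s ^+ 2 * w i],
      q`_0 = f.@[x] & q`_1 = dirderiv v x f].
Proof.
elim/mpoly_alg_ind: f => [c|i|f g [q [qE q0 q1]] [r [rE r0 r1]]
  |f g [q [qE q0 q1]] [r [rE r0 r1]]].
- by exists c%:P; split=> [s||]; rewrite ?hornerC ?mevalC ?coefC ?dirderivC.
- exists ((x i)%:P + v i *: 'X + w i *: 'X^2); split=> [s||].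
  + by rewrite !(hornerD, hornerZ) hornerC hornerX hornerXn mevalXU; ring.
  + by rewrite !coefE mevalXU /= !mulr0 !addr0.
  + by rewrite !coefE dirderivX /= !mulr0 mulr1 addr0 add0r.
- exists (q + r); split=> [s||].
  + by rewrite hornerD qE rE mevalD.
  + by rewrite coefD q0 r0 mevalD.
  + by rewrite coefD q1 r1 dirderivD.
- exists (q * r); split=> [s||].
  + by rewrite hornerM qE rE mevalM.
  + by rewrite coefM big_ord1 q0 r0 mevalM.
  + by rewrite coefM big_ord_recl big_ord1 /= q0 r0 q1 r1 dirderivM addrC.
Qed.

(** The Zariski tangent space at [x], inside the ambient affine space. *)
Definition tangent (X : set ('I_n -> K)) x v :=
  forall f, (forall y, X y -> f.@[y] = 0) -> dirderiv v x f = 0.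

Lemma tangent_sum X x (I : finType) (b : I -> K) (u : I -> 'I_n -> K) :
  (forall i, tangent X x (u i)) -> tangent X x (fun j => \sum_i b i * u i j).
Proof.
by move=> uX f fX; rewrite dirderiv_sum big1 // => i _; rewrite uX ?mulr0.
Qed.

End DirectionalDerivative.

(** A polynomial vanishing on [X] vanishes on its closure, so its restriction to the curve is zero
    at all but finitely many parameters, hence identically; its linear coefficient is the derivative
    along [v]. *)
Lemma tangent_curve (K : closedFieldType) n (X : set ('I_n -> K)) x v w
    (r : {poly K}) : r != 0 ->
  (forall s, r.[s] != 0 -> zariski_closure X (fun i => x i + s * v i + s ^+ 2 * w i)) ->
  tangent X x v.
Proof.
move=> r0 rX f fX; have [q [qE _ <-]] := dirderiv_curve v w x f.
suff -> : q = 0 by rewrite coef0.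
by apply: (poly_eq0_closed r0) => s rs; rewrite qE; apply: rX.
Qed.

(** * Values and derivatives of germs, and generators of the maximal ideal *)

Section LocalRing.
Variables (K : fieldType) (n : nat) (X : set ('I_n -> K)) (x : 'I_n -> K).
Hypothesis Xx : X x.
Local Notation O := (local_ring Xx).
Implicit Types (a b : fracs x) (c : O).

Definition to_germ a : O := \pi_(germ X x) a.

Lemma to_germ_repr c : to_germ (repr (c : germ X x)) = c.
Proof. exact: reprK. Qed.

Lemma to_germ_eqP a b : (exists2 h : {mpoly K[n]}, h.@[x] != 0 & forall y, X y ->
     h.@[y] * ((num a).@[y] * (den b).@[y] - (num b).@[y] * (den a).@[y]) = 0)
  <-> to_germ a = to_germ b.
Proof. exact: germ_eqP. Qed.

Lemma to_germD a b : to_germ a + to_germ b = to_germ (add_frac a b).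
Proof. exact/esym/pi_germ_add. Qed.

Lemma to_germM a b : to_germ a * to_germ b = to_germ (mul_frac a b).
Proof. exact/esym/pi_germ_mul. Qed.

Definition poly_germ (f : {mpoly K[n]}) : O := to_germ (frac f (den1_neq0 x)).

Lemma poly_germ_is_zmod : zmod_morphism poly_germ.
Proof.
move=> f g; apply: (addIr (poly_germ g)); rewrite subrK to_germD.
by apply/germ_eq_cross; rewrite /add_frac /frac /num /den /=; ring.
Qed.

Lemma poly_germ_is_monoid : monoid_morphism poly_germ.
Proof.
split=> [|f g]; first by rewrite /poly_germ /to_germ -[RHS]/(germ1 X x) !piE.
by rewrite to_germM; apply/germ_eq_cross; rewrite /mul_frac /frac /num /den /=; ring.
Qed.

HB.instance Definition _ := GRing.isZmodMorphism.Build _ _ poly_germ poly_germ_is_zmod.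
HB.instance Definition _ := GRing.isMonoidMorphism.Build _ _ poly_germ poly_germ_is_monoid.

Lemma poly_germ_eq0 f : (forall y, X y -> f.@[y] = 0) -> poly_germ f = 0.
Proof.
move=> fX; rewrite -(rmorph0 poly_germ); apply/to_germ_eqP.
exists 1; first exact: den1_neq0.
by move=> y Xy; rewrite /frac /num /den /= fX // meval0; ring.
Qed.

Lemma to_germ_den a : to_germ a * poly_germ (den a) = poly_germ (num a).
Proof.
by rewrite to_germM; apply/germ_eq_cross; rewrite /mul_frac /frac /num /den /=; ring.
Qed.

Lemma poly_germ_unit g : g.@[x] != 0 -> exists c, c * poly_germ g = 1.
Proof.
move=> gx; exists (to_germ (frac 1 gx)); rewrite to_germM -(rmorph1 poly_germ).
by apply/germ_eq_cross; rewrite /mul_frac /frac /num /den /=; ring.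
Qed.

Definition germ_val c := (num (repr (c : germ X x))).@[x] / (den (repr (c : germ X x))).@[x].

Definition frac_deriv v a :=
  (dirderiv v x (num a) * (den a).@[x] - (num a).@[x] * dirderiv v x (den a))
  / (den a).@[x] ^+ 2.

Definition germ_deriv v c := frac_deriv v (repr (c : germ X x)).

Lemma germ_valE a : germ_val (to_germ a) = (num a).@[x] / (den a).@[x].
Proof.
have /to_germ_eqP[h hx /(_ x Xx)/eqP] := to_germ_repr (to_germ a).
rewrite mulf_eq0 (negPf hx) subr_eq0 /= => /eqP E.
by apply/eqP; rewrite eqr_div ?den_neq0 //; apply/eqP.
Qed.

(** Independence of the representative: the relation between two fractions of one germ vanishes on
    [X], so tangency of [v] allows differentiating it. The factor [h] drops out because it is
    nonzero at [x] while the bracket it multiplies is zero there. *)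
Lemma germ_derivE v a : tangent X x v ->
  germ_deriv v (to_germ a) = frac_deriv v a.
Proof.
rewrite /germ_deriv => tv.
have /to_germ_eqP[h hx hX] := to_germ_repr (to_germ a).
move: (repr _) hX => b hX.
have /eqP E0 := hX x Xx; rewrite mulf_eq0 (negPf hx) /= in E0.
have {hX} E1 : dirderiv v x (h * (num b * den a - num a * den b)) = 0.
  by apply: tv => y Xy; rewrite !(mevalM, mevalD, mevalN) hX.
move: E1; rewrite dirderivM !(mevalM, mevalD, mevalN) (eqP E0) mulr0 add0r.
move=> /eqP; rewrite mulf_eq0 (negPf hx) /= !(dirderivD, dirderivN, dirderivM).
move=> /eqP E1; apply/eqP; rewrite /frac_deriv eqr_div ?expf_neq0 ?den_neq0 //.
rewrite -subr_eq0; apply/eqP.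
(* With denominators cleared, the goal is a combination of the differentiated relation [E1] and the
   relation [E0] at [x]. *)
have := congr2 (fun s t => (den a).@[x] * (den b).@[x] * s -
  (dirderiv v x (den a) * (den b).@[x] + (den a).@[x] * dirderiv v x (den b)) * t)
  E1 (eqP E0).
by rewrite /= !mulr0 subrr => <-; ring.
Qed.

Lemma germ_valM c d : germ_val (c * d) = germ_val c * germ_val d.
Proof.
rewrite -(to_germ_repr c) -(to_germ_repr d) to_germM !germ_valE /mul_frac /frac.
by rewrite /num /den /= !mevalM mulf_div.
Qed.

Lemma germ_valD c d : germ_val (c + d) = germ_val c + germ_val d.
Proof.
rewrite -(to_germ_repr c) -(to_germ_repr d) to_germD !germ_valE /add_frac /frac.
by rewrite [in RHS]addf_div ?den_neq0 // /num /den /= !(mevalD, mevalM).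
Qed.

Lemma germ_val_poly f : germ_val (poly_germ f) = f.@[x].
Proof. by rewrite germ_valE /frac /num /den /= meval1 divr1. Qed.

Lemma germ_derivM v c d : tangent X x v ->
  germ_deriv v (c * d) = germ_deriv v c * germ_val d + germ_val c * germ_deriv v d.
Proof.
move=> tv; rewrite -(to_germ_repr c) -(to_germ_repr d) to_germM !germ_derivE //.
move: (repr _) (repr _) => b a; rewrite !germ_valE /frac_deriv /mul_frac /frac.
have := den_neq0 a; have := den_neq0 b; rewrite /num /den /=.
by rewrite !(mevalM, dirderivM) => ? ?; field; apply/andP.
Qed.

Lemma germ_derivD v c d : tangent X x v ->
  germ_deriv v (c + d) = germ_deriv v c + germ_deriv v d.
Proof.
move=> tv; rewrite -(to_germ_repr c) -(to_germ_repr d) to_germD !germ_derivE //.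
move: (repr _) (repr _) => b a; rewrite /frac_deriv /add_frac /frac.
have := den_neq0 a; have := den_neq0 b; rewrite /num /den /=.
by rewrite !(mevalD, dirderivD, mevalM, dirderivM) => ? ?; field; apply/andP.
Qed.

Lemma germ_deriv_poly v f : tangent X x v ->
  germ_deriv v (poly_germ f) = dirderiv v x f.
Proof.
move=> tv; rewrite germ_derivE // /frac_deriv /frac /num /den /=.
by rewrite meval1 -mpolyC1 dirderivC mulr0 subr0 expr1n !mulr1 invr1 mulr1.
Qed.

Lemma germ_val_inv c : germ_val c != 0 -> exists d, d * c = 1.
Proof.
rewrite -(to_germ_repr c) germ_valE => c0.
have nc : (num (repr (c : germ X x))).@[x] != 0.
  by apply: contraNneq c0 => ->; rewrite mul0r.
have [d dc] := poly_germ_unit nc.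
exists (d * poly_germ (den (repr (c : germ X x)))).
by rewrite -mulrA [poly_germ _ * _]mulrC to_germ_den.
Qed.

(** A germ with nonzero value is a unit, so [m] lies in the ideal of germs with value 0, and
    maximality gives equality. *)
Lemma maximal_idealP (m : {pred O}) c : maximal_ideal m -> (c \in m) = (germ_val c == 0).
Proof.
move=> [idm maxm].
have vm : {subset m <= [pred c | germ_val c == 0]}.
  move=> d dm; rewrite inE; apply: contraT => /germ_val_inv[e ed].
  by case: idm (idealM e idm dm) => _ /negPf m1 _; rewrite ed m1.
rewrite -(maxm [pred c | germ_val c == 0]) ?inE //; split.
- by rewrite inE -(rmorph0 poly_germ) germ_val_poly meval0.
- by rewrite inE -(rmorph1 poly_germ) germ_val_poly meval1 oner_eq0.
- move=> d e f; rewrite !inE => /eqP e0 /eqP f0.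
  by rewrite germ_valD germ_valM e0 f0 mulr0 addr0.
Qed.

(** Derivation along a tangent vector is determined on [m] by its values on generators. If there
    were more vectors than generators, a nontrivial combination of them would kill all of [m]. *)
Lemma tangent_family_le (m : {pred O}) (s : seq O) (I : finType) (u : I -> 'I_n -> K) :
  maximal_ideal m -> generated_by s m -> (forall i, tangent X x (u i)) ->
  (forall b : I -> K, (forall j, \sum_i b i * u i j = 0) -> forall i, b i = 0) ->
  (#|I| <= size s)%N.
Proof.
move=> maxm gens tu free; rewrite leqNgt; apply/negP => ltsI.
have [|b [i bi] bs] :=
  @linear_dependence K I 'I_(size s) (fun i j => germ_deriv (u i) s`_j).
  by rewrite card_ord.
case/eqP: bi; apply: (free b) => j.
pose v k := \sum_i b i * u i k; have tv : tangent X x v by exact: tangent_sum.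
have vs k : (k < size s)%N -> germ_deriv v s`_k = 0.
  move=> ks; rewrite -[RHS](bs (Ordinal ks)) /= -(to_germ_repr s`_k) germ_derivE //.
  rewrite /frac_deriv !dirderiv_sum [X in X - _]mulr_suml mulr_sumr -sumrB mulr_suml.
  by apply: eq_bigr => l _; rewrite germ_derivE // /frac_deriv; ring.
(* This coordinate function, shifted to vanish at [x], lies in [m], and its derivative along [v] is
   the entry [v j]. *)
pose f : {mpoly K[n]} := 'X_j - (x j)%:MP.
have fx : f.@[x] = 0 by rewrite mevalB mevalXU mevalC subrr.
have : poly_germ f \in m by rewrite maximal_idealP // germ_val_poly fx.
move=> /gens[c fE].
have := germ_deriv_poly f tv.
rewrite dirderivD dirderivN dirderivC subr0 dirderivX => vj.
rewrite -[LHS]/(v j) -vj fE.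
have D0 : germ_deriv v 0 = 0.
  by rewrite -(rmorph0 poly_germ) germ_deriv_poly // -mpolyC0 dirderivC.
rewrite (big_morph (germ_deriv v) (fun d e : O => germ_derivD d e tv) D0).
apply: big1 => k _; rewrite germ_derivM // vs // mulr0 addr0.
suff /eqP-> : germ_val s`_k == 0 by rewrite mulr0.
rewrite -(maximal_idealP _ maxm); apply/gens.
exists (fun l => (l == k)%:R); rewrite (bigD1 k) //= eqxx mul1r big1 ?addr0 //.
by move=> l /negPf->; rewrite mul0r.
Qed.

End LocalRing.

(** * The dimension of a parametrised variety *)

Lemma card_bmultinom r B : (#|{: 'X_{1..r < B}}| <= B ^ r)%N.
Proof.
have ltB (m : 'X_{1..r < B}) i : ((m : 'X_{1..r}) i < B)%N.
  apply: leq_ltn_trans (bmdeg m); rewrite mdegE (bigD1 i) //=; exact: leq_addr.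
pose g (m : 'X_{1..r < B}) := [ffun i => Ordinal (ltB m i)].
have <- : #|{ffun 'I_r -> 'I_B}| = (B ^ r)%N by rewrite card_ffun !card_ord.
apply: (@leq_card _ _ g) => m1 m2 /ffunP g12.
apply/eqP; rewrite bmeqP; apply/eqP/mnmP => i.
by have := g12 i; rewrite !ffunE => /(congr1 val).
Qed.

Section HomogenisedMonomials.
Variable D : nat.

(** The numerator of a monomial in the fractions [a i / b i] over the common denominator
    [\prod_(i < e) b i ^+ D]. *)
Fixpoint hmonomial (R : comNzRingType) (e : nat) (a b : nat -> R) :
    exponents e D -> R :=
  if e is e'.+1 then
    fun m => a 0 ^+ (m : 'I_D * exponents e' D).1 * b 0 ^+ (D - m.1) *
      hmonomial (a \o S) (b \o S) m.2
  else fun=> 1.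

Lemma hmonomialE (R : comNzRingType) e (f a b : nat -> R) m :
  (forall i, f i * b i = a i) ->
  @hmonomial R e a b m = monomial f m * \prod_(i < e) b i ^+ D.
Proof.
elim: e f a b m => [|e IH] f a b m fba; first by rewrite big_ord0 mulr1.
case: m => i m /=; rewrite (IH (f \o S)) => [|j]; last exact: fba.
have bD : b 0 ^+ D = b 0 ^+ i * b 0 ^+ (D - i).
  by rewrite -exprD subnKC // ltnW.
rewrite big_ord_recl -fba exprMn bD.
by rewrite /bump /=; ring.
Qed.

Lemma rmorph_hmonomial (R S : comNzRingType) (h : {rmorphism R -> S}) e
    (a b : nat -> R) m :
  h (@hmonomial R e a b m) = hmonomial (h \o a) (h \o b) m.
Proof.
elim: e a b m => [|e IH] a b m; first exact: rmorph1.
by rewrite !rmorphM !rmorphXn /= IH.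
Qed.

Lemma msizeM_leS (K : fieldType) r (p q : {mpoly K[r]}) M N :
  (msize p <= M.+1)%N -> (msize q <= N.+1)%N -> (msize (p * q) <= (M + N).+1)%N.
Proof.
have [->|p0] := eqVneq p 0; first by rewrite mul0r msize0.
have [->|q0] := eqVneq q 0; first by rewrite mulr0 msize0.
move=> pM qN; rewrite msizeM //; have := leq_add pM qN.
by rewrite addSn addnS; case: (_ + _)%N.
Qed.

Lemma msizeX_leS (K : fieldType) r (p : {mpoly K[r]}) M k :
  (msize p <= M.+1)%N -> (msize (p ^+ k) <= (k * M).+1)%N.
Proof.
move=> pM; elim: k => [|k IH]; first by rewrite expr0 msize1.
by rewrite exprS mulSn; apply: msizeM_leS.
Qed.

Lemma msize_hmonomial (K : fieldType) r (e : nat) (a b : nat -> {mpoly K[r]}) M m :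
  (forall i, (i < e)%N -> (msize (a i) <= M.+1)%N /\ (msize (b i) <= M.+1)%N) ->
  (msize (@hmonomial _ e a b m) <= (e * (D * M)).+1)%N.
Proof.
elim: e a b m => [|e IH] a b m abM; first by rewrite /= msize1.
rewrite mulSn; apply: msizeM_leS; last by apply: IH => i; apply: (abM i.+1).
have [a0 b0] := abM 0%N isT.
have -> : (D * M = m.1 * M + (D - m.1) * M)%N.
  by rewrite -mulnDl subnKC // ltnW.
by apply: msizeM_leS; apply: msizeX_leS.
Qed.

End HomogenisedMonomials.

(** The maps [pi j] act as charts from affine r-space that cover [X] up to closure. If a chain were
    longer than [r], one linear system for all charts at once would give a nontrivial relation among
    the independent germs of the chain. *)
Lemma krull_dim_parametrised (K : fieldType) (n r d : nat) (X : set ('I_n -> K))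
    (x : 'I_n -> K) (Xx : X x) (J : finType) (pi : J -> n.-tuple {mpoly K[r]}) :
  (forall f : {mpoly K[n]}, (forall j, f \mPo pi j = 0) ->
     forall y, X y -> f.@[y] = 0) ->
  krull_dim (local_ring Xx) d -> (d <= r)%N.
Proof.
move=> piX [[C chainC] _]; rewrite leqNgt; apply/negP => ltrd.
pose k c : local_ring Xx := poly_germ Xx c%:MP.
have [||f fP] := chain_independent (k := k) _ _ chainC.
- by rewrite /k mpolyC0 rmorph0.
- move=> P c idP kc; apply/eqP; apply: contraT => c0.
  case: (idP) => _ /negP[]; rewrite -(rmorph1 (poly_germ Xx)) -mpolyC1.
  by rewrite -(mulVf c0) mpolyCM rmorphM; apply: idealM.
pose A i := num (repr (f i : germ X x)); pose B i := den (repr (f i : germ X x)).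
have fBA i : f i * poly_germ Xx (B i) = poly_germ Xx (A i).
  by rewrite -{1}(to_germ_repr (f i)) to_germ_den.
pose Aj j i := A i \mPo pi j; pose Bj j i := B i \mPo pi j.
pose M := (\max_j \max_(i < d) maxn (msize (Aj j i)) (msize (Bj j i)))%N.
have ABM j i : (i < d)%N -> (msize (Aj j i) <= M.+1)%N /\ (msize (Bj j i) <= M.+1)%N.
  move=> id; suff: (maxn (msize (Aj j i)) (msize (Bj j i)) <= M.+1)%N.
    by rewrite geq_max => /andP.
  apply: leqW; rewrite /M; apply: (leq_trans _ (leq_bigmax j)).
  exact: (leq_bigmax (F := fun i : 'I_d => maxn (msize (Aj j i)) (msize (Bj j i))) (Ordinal id)).
(* There are D^d monomials in the f_i, but after clearing denominators their
   pullbacks lie in a space of dimension O(D^r). *)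
pose D := (#|J| * (d * M + 1) ^ r).+1.
pose N := (d * (D * M)).+1.
have [|c [m cm] c0] := @linear_dependence K (exponents d D)
    (J * 'X_{1..r < N})%type (fun m jk => (hmonomial (Aj jk.1) (Bj jk.1) m)@_jk.2).
  (* Since [N <= D * (d * M + 1)], the number of equations is at most [#|J| * (d * M + 1) ^ r * D ^
     r < D ^ r.+1 <= D ^ d]. *)
  rewrite card_prod card_exponents.
  apply: (@leq_ltn_trans (#|J| * N ^ r)); first by rewrite leq_mul2l card_bmultinom orbT.
  apply: (@leq_ltn_trans (#|J| * (D * (d * M + 1)) ^ r)).
    rewrite leq_mul2l; apply/orP; right; case: (posnP r) => [->//|r0].
    by rewrite leq_exp2r // /N; lia.
  rewrite expnMn mulnCA; apply: (@leq_trans (D ^ r.+1)); last by rewrite leq_pexp2l.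
  by rewrite expnSr ltn_pmul2l // expn_gt0.
pose F := \sum_m (c m)%:MP * hmonomial A B m.
have F0 j : F \mPo pi j = 0.
  rewrite /F rmorph_sum /=; apply/mpolyP => l; rewrite mcoeff0.
  rewrite (eq_bigr (fun m => c m *: hmonomial (Aj j) (Bj j) m)); last first.
    by move=> m' _; rewrite rmorphM /= comp_mpolyC mul_mpolyC rmorph_hmonomial.
  rewrite (raddf_sum (mcoeff l)) /=.
  have [lN|lN] := ltnP (mdeg l) N.
    rewrite -[RHS](c0 (j, BMultinom lN)); apply: eq_bigr => m' _.
    by rewrite mcoeffZ.
  apply: big1 => m' _; rewrite mcoeffZ memN_msupp_eq0 ?mulr0 //.
  by apply: msize_mdeg_ge; apply: leq_trans lN; apply: msize_hmonomial; apply: ABM.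
have : poly_germ Xx F = 0 by apply: poly_germ_eq0; apply: piX.
rewrite rmorph_sum /= (eq_bigr (fun m =>
   k (c m) * monomial f m * \prod_(i < d) poly_germ Xx (B i) ^+ D)); last first.
  by move=> m' _; rewrite rmorphM rmorph_hmonomial (hmonomialE _ fBA) mulrA.
rewrite -mulr_suml => E0.
(* The denominators are nonzero at [x], so their product is a unit and cancels from the relation. *)
have [u uB] : exists u, u * \prod_(i < d) poly_germ Xx (B i) ^+ D = 1.
  have [|u uB] := @poly_germ_unit K n X x Xx (\prod_(i < d) B i ^+ D).
    rewrite rmorph_prod; apply/prodf_neq0 => i _ /=.
    by rewrite rmorphXn expf_neq0 // den_neq0.
  exists u; rewrite -[RHS]uB rmorph_prod; congr (_ * _).
  by apply: eq_bigr => i _; rewrite rmorphXn.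
case/eqP: cm; apply: (fP D c).
suff -> : \sum_m k (c m) * monomial f m = 0.
  by apply: ideal0; case: chainC => /(_ 0%N isT)[].
by rewrite -[LHS]mulr1 -uB mulrCA E0 mulr0.
Qed.

(** * Three by three matrices *)

Section ThreeByThree.
Variable R : comNzRingType.
Implicit Types A B : 'M[R]_3.

Lemma ord3_ind (P : 'I_3 -> Prop) : P 0 -> P 1 -> P 2 -> forall i, P i.
Proof.
move=> P0 P1 P2 [[|[|[|//]]] lti].
- by rewrite (_ : Ordinal lti = 0) //; apply: val_inj.
- by rewrite (_ : Ordinal lti = 1) //; apply: val_inj.
- by rewrite (_ : Ordinal lti = 2) //; apply: val_inj.
Qed.

Lemma sum_ord3 (F : 'I_3 -> R) : \sum_i F i = F 0 + F 1 + F 2.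
Proof.
rewrite !big_ord_recl big_ord0 addr0 addrA.
by congr (_ + F _ + F _); apply: val_inj.
Qed.

Lemma mulmx3 A B i j : (A *m B) i j = A i 0 * B 0 j + A i 1 * B 1 j + A i 2 * B 2 j.
Proof. by rewrite mxE sum_ord3. Qed.

Lemma mxtrace_mul_delta A i j : \tr (A *m delta_mx i j) = A j i.
Proof.
rewrite /mxtrace (bigD1 j) //= big1 => [|k kj].
  rewrite addr0 mxE (bigD1 i) //= big1 => [|k ki].
    by rewrite mxE !eqxx mulr1 addr0.
  by rewrite mxE (negPf ki) mulr0.
by rewrite mxE big1 // => l _; rewrite mxE (negPf kj) andbF mulr0.
Qed.

(* [lower_uni] parametrises the big cell of G / P_sub, and [upper_par q] the elements
   of P_sub with q Ad = 1 on g_2; hence the nine parameters of [chart]. *)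
Definition lower_uni (x y z : R) : 'M[R]_3 :=
  \matrix_(i, j) nth 0 (nth [::] [:: [:: 1; 0; 0]; [:: x; 1; z]; [:: y; 0; 1]] i) j.

Definition upper_par (q a b c d e : R) : 'M[R]_3 :=
  \matrix_(i, j) nth 0 (nth [::] [:: [:: a; b; c]; [:: 0; q * a; 0]; [:: 0; d; e]] i) j.

Lemma lower_uniK x y z : lower_uni x y z *m lower_uni (z * y - x) (- y) (- z) = 1.
Proof.
by apply/matrixP; elim/ord3_ind; elim/ord3_ind; rewrite mulmx3 !mxE /=; ring.
Qed.

Lemma lower_uniVK x y z : lower_uni (z * y - x) (- y) (- z) *m lower_uni x y z = 1.
Proof.
by apply/matrixP; elim/ord3_ind; elim/ord3_ind; rewrite mulmx3 !mxE /=; ring.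
Qed.

(** The inverse [u'] of [u] is written out, so that the chart is polynomial in its parameters and
    makes sense over a polynomial ring. *)
Definition chart (q : R) (v : 'I_9 -> R) : 'M[R]_3 * 'M[R]_3 :=
  let: u := lower_uni (v 0) (v 1) (v 2) in
  let: u' := lower_uni (v 2 * v 1 - v 0) (- v 1) (- v 2) in
  (u *m upper_par q (v 3) (v 4) (v 5) (v 6) (v 7) *m u', v 8 *: (u *m delta_mx 0 1 *m u')).

Definition conj_perm (s : 'S_3) (A : 'M[R]_3) : 'M[R]_3 := row_perm s (col_perm s A).

Lemma conj_permK s A : conj_perm s (conj_perm s^-1%g A) = A.
Proof. by apply/matrixP => i j; rewrite !mxE !permK. Qed.

Lemma conj_permKV s A : conj_perm s^-1%g (conj_perm s A) = A.
Proof. by rewrite -{2}[s]invgK conj_permK. Qed.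

Lemma conj_permM s A B : conj_perm s (A *m B) = conj_perm s A *m conj_perm s B.
Proof.
apply/matrixP => i j; rewrite !mxE (reindex_inj (@perm_inj _ s)).
by apply: eq_bigr => k _; rewrite !mxE.
Qed.

End ThreeByThree.

Lemma map_chart (R S : comNzRingType) (h : {rmorphism R -> S}) (q : R) v :
  (map_mx h (chart q v).1, map_mx h (chart q v).2) = chart (h q) (h \o v).
Proof.
have hu x y z : map_mx h (lower_uni x y z) = lower_uni (h x) (h y) (h z).
  by apply/matrixP; elim/ord3_ind; elim/ord3_ind; rewrite !mxE /= ?rmorph0 ?rmorph1.
have hp a b c d e :
    map_mx h (upper_par q a b c d e) = upper_par (h q) (h a) (h b) (h c) (h d) (h e).
  by apply/matrixP; elim/ord3_ind; elim/ord3_ind; rewrite !mxE /= ?rmorph0 ?rmorphM.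
rewrite /chart /= !(map_mxM, map_mxZ) !hu hp !(rmorphB, rmorphN, rmorphM).
by rewrite map_delta_mx.
Qed.

(** * Covering the pairs with a rank one nilpotent by charts *)

Section Charts.
Variables (K : fieldType) (q : K).
Hypothesis q0 : q != 0.
Implicit Types (A B N Phi : 'M[K]_3).

(** The flag consists of the line spanned by [v] and the plane [eta = 0]; it lies in the big cell
    because [v 0] and [eta 1] are nonzero. The matrix [u] carries the standard flag to it. *)
Lemma chart_cover N Phi (v eta : 'I_3 -> K) :
  (forall i j, N i j = v i * eta j) -> v 0 != 0 -> eta 1 != 0 ->
  \sum_i eta i * v i = 0 -> N *m Phi = q *: (Phi *m N) ->
  exists w, chart q w = (Phi, N).
Proof.
move=> NE v0 eta1 eta_v NPhi.
pose x := v 1 / v 0; pose y := v 2 / v 0; pose z := - eta 2 / eta 1.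
pose u := lower_uni x y z; pose u' := lower_uni (z * y - x) (- y) (- z).
have uu' : u *m u' = 1 by exact: lower_uniK.
have u'u : u' *m u = 1 by exact: lower_uniVK.
pose t := v 0 * eta 1.
have t0 : t != 0 by rewrite mulf_neq0.
have eta0E : eta 0 = - (eta 1 * v 1 + eta 2 * v 2) / v 0.
  move: eta_v; rewrite sum_ord3 => /eqP; rewrite -addrA addr_eq0 => /eqP E.
  by apply: (mulIf v0); rewrite E divfK.
have NuE : N = t *: (u *m delta_mx 0 1 *m u').
  apply/matrixP; elim/ord3_ind; elim/ord3_ind;
    rewrite NE !mxE !sum_ord3 !mxE !sum_ord3 !mxE /= ?eta0E /t /x /y /z;
    by field; rewrite ?v0 ?eta1.
pose F := u' *m Phi *m u.
have PhiE : Phi = u *m F *m u'.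
  by rewrite /F !mulmxA uu' mul1mx -mulmxA uu' mulmx1.
have FE : delta_mx 0 1 *m F = q *: (F *m delta_mx 0 1).
  have EF : u' *m (N *m Phi) *m u = t *: (delta_mx 0 1 *m F).
    by rewrite NuE /F -!(scalemxAl, scalemxAr) !mulmxA u'u mul1mx.
  have FE : u' *m (Phi *m N) *m u = t *: (F *m delta_mx 0 1).
    by rewrite NuE /F -!(scalemxAl, scalemxAr) -!mulmxA u'u mulmx1.
  apply: (scalerI t0); rewrite -EF NPhi -scalemxAr -scalemxAl FE !scalerA.
  by rewrite mulrC.
clearbody F; have FEij i j := congr1 (fun A : 'M[K]_3 => A i j) FE.
(* Four entries of [FE] give the shape of [upper_par]; the one at [(2, 1)] is [q * F 2 0 = 0]. *)
have /= := FEij 0 0; have /= := FEij 0 1; have /= := FEij 0 2; have /= := FEij 2 1.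
rewrite !(mulmx3, mxE) /= !(mul0r, mulr0, mul1r, mulr1, add0r, addr0).
move=> /esym/eqP; rewrite mulf_eq0 (negPf q0) /= => /eqP F20 F12 F11 F10.
exists (fun i => nth 0 [:: x; y; z; F 0 0; F 0 1; F 0 2; F 2 1; F 2 2; t] i).
rewrite /chart /= -[lower_uni x y z]/u -[lower_uni _ (- y) _]/u' -NuE.
suff -> : upper_par q (F 0 0) (F 0 1) (F 0 2) (F 2 1) (F 2 2) = F by rewrite -PhiE.
by apply/matrixP; elim/ord3_ind; elim/ord3_ind; rewrite [LHS]mxE.
Qed.

(* A nonzero diagonal rank one matrix is not nilpotent, so six permuted copies of
   the chart suffice. *)
Lemma nilpotent_offdiag (v eta : 'I_3 -> K) :
  (exists i, v i != 0) -> (exists i, eta i != 0) -> \sum_i eta i * v i = 0 ->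
  exists s : 'S_3, v (s 0) != 0 /\ eta (s 1) != 0.
Proof.
move=> [k vk] [l el] ev.
have {l el} [l lk el] : exists2 l, l != k & eta l != 0.
  have [lk|lk] := eqVneq l k; last by exists l.
  rewrite -{}lk {k} in vk *; apply: contrapT => H.
  move/eqP: ev; rewrite (bigD1 l) //= big1 => [|j jl].
    by rewrite addr0 mulf_eq0 (negPf el) (negPf vk).
  suff /eqP-> : eta j == 0 by rewrite mul0r.
  by apply: contraT => ej; case: H; exists j.
pose l' := tperm 0 k l.
have l'0 : l' != 0.
  by apply: contra lk => /eqP E; rewrite -(tpermK 0 k l) -/l' E tpermL.
exists (tperm 1%R l' * tperm 0%R k)%g; rewrite !permM.
by split; [rewrite [tperm _ _ 0]tpermD // tpermL | rewrite tpermL tpermK].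
Qed.

Lemma rank_one_chart N Phi (v eta : 'I_3 -> K) :
  (forall i j, N i j = v i * eta j) -> (exists i, v i != 0) ->
  (exists i, eta i != 0) -> \sum_i eta i * v i = 0 ->
  N *m Phi = q *: (Phi *m N) ->
  exists s w, (Phi, N) = (conj_perm s (chart q w).1, conj_perm s (chart q w).2).
Proof.
move=> NE v0 eta0 ev NPhi; have [s [vs es]] := nilpotent_offdiag v0 eta0 ev.
have [|||w wE] := @chart_cover (conj_perm s N) (conj_perm s Phi) (v \o s) (eta \o s) _ vs es.
- by move=> i j; rewrite !mxE NE.
- by rewrite -[RHS]ev [RHS](reindex_inj (@perm_inj _ s)).
- by rewrite -!conj_permM NPhi; apply/matrixP => i j; rewrite !mxE.
by exists s^-1%g, w; rewrite wE /= !conj_permKV.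
Qed.

End Charts.

(** * Curves in X_sub *)

Section Conjugation.
Variable K : fieldType.
Implicit Types (g h A B : 'M[K]_3).

Lemma AdD g A B : Ad g (A + B) = Ad g A + Ad g B.
Proof. by rewrite /Ad mulmxDr mulmxDl. Qed.

Lemma AdZ g c A : Ad g (c *: A) = c *: Ad g A.
Proof. by rewrite /Ad -scalemxAr -scalemxAl. Qed.

Lemma AdM g h A : g \in unitmx -> h \in unitmx -> Ad (g *m h) A = Ad g (Ad h A).
Proof.
move=> gu hu; rewrite /Ad.
suff -> : invmx (g *m h) = invmx h *m invmx g by rewrite !mulmxA.
exact: (@invrM 'M[K]_3).
Qed.

Lemma Ad_mulmx g A B : g \in unitmx -> Ad g (A *m B) = Ad g A *m Ad g B.
Proof. by move=> gu; rewrite /Ad !mulmxA mulmxKV. Qed.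

Lemma AdK g A : g \in unitmx -> Ad (invmx g) (Ad g A) = A.
Proof. by move=> gu; rewrite /Ad invmxK !mulmxA mulVmx // mul1mx mulmxKV. Qed.

Lemma AdVK g A : g \in unitmx -> Ad g (Ad (invmx g) A) = A.
Proof. by move=> gu; rewrite /Ad invmxK !mulmxA mulmxV // mul1mx mulmxK. Qed.

Lemma Ad_unitmx g A : g \in unitmx -> (Ad g A \in unitmx) = (A \in unitmx).
Proof. by move=> gu; rewrite /Ad !unitmx_mul unitmx_inv gu andbT. Qed.

Lemma Ad_inv g A : g \in unitmx -> A \in unitmx -> invmx (Ad g A) = Ad g (invmx A).
Proof.
move=> gu Au; have AgA : Ad g A \in unitmx by rewrite Ad_unitmx.
rewrite -[RHS](mulKmx AgA) -Ad_mulmx // mulmxV //.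
by rewrite /Ad mulmx1 mulmxV // mulmx1.
Qed.

Lemma Ad_Ad g A B : g \in unitmx -> A \in unitmx -> Ad (Ad g A) (Ad g B) = Ad g (Ad A B).
Proof.
move=> gu Au; rewrite -[LHS]/(Ad g A *m Ad g B *m invmx (Ad g A)) Ad_inv //.
by rewrite -!Ad_mulmx.
Qed.

Lemma coordsP (c : K) (x y : 'M[K]_3 * 'M[K]_3) k :
  coords (c *: x + y) k = c * coords x k + coords y k.
Proof. by rewrite /coords /= !linearP /= -add_row_mx -scale_row_mx !mxE. Qed.

Lemma coords0 k : coords (0 : 'M[K]_3 * 'M[K]_3) k = 0.
Proof. by rewrite /coords /= !linear0 row_mx0 mxE. Qed.

Lemma coords_sum (I : finType) (b : I -> K) (x : I -> 'M[K]_3 * 'M[K]_3) k :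
  coords (\sum_i b i *: x i) k = \sum_i b i * coords (x i) k.
Proof.
have D (y z : 'M[K]_3 * 'M[K]_3) : coords (y + z) k = coords y k + coords z k.
  by have := coordsP 1 y z k; rewrite scale1r mul1r.
rewrite (big_morph _ D (coords0 k)); apply: eq_bigr => i _.
by have := coordsP (b i) (x i) 0 k; rewrite addr0 coords0 addr0.
Qed.

Lemma coords_eq0 (x : 'M[K]_3 * 'M[K]_3) : (forall k, coords x k = 0) -> x = 0.
Proof.
case: x => A B AB0; have /eqP : row_mx (mxvec A) (mxvec B) = 0.
  by apply/rowP => k; rewrite [RHS]mxE -(AB0 k).
by rewrite row_mx_eq0 !mxvec_eq0 => /andP[/eqP-> /eqP->].
Qed.

Lemma coords_curve (A B C N N' : 'M[K]_3) s :
  coords (A + s *: B + s ^+ 2 *: C, N + s *: N') =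
  fun k => coords (A, N) k + s * coords (B, N') k + s ^+ 2 * coords (C, 0) k.
Proof.
have -> : (A + s *: B + s ^+ 2 *: C, N + s *: N') =
    s *: (B, N') + (s ^+ 2 *: (C, 0) + (A, N)).
  apply: injective_projections => /=.
    by rewrite [RHS]addrC [_ + A]addrC addrAC.
  by rewrite scaler0 add0r addrC.
by apply/funext => k; rewrite !coordsP; ring.
Qed.

(* For invertible [A] this says that [A] lies in P_sub and that q Ad(A) fixes E_12;
   as stated it is linear in [A]. *)
Definition adapted (q : K) A := [/\ A 1 0 = 0, A 1 2 = 0, A 2 0 = 0 & A 1 1 = q * A 0 0].

Lemma adapted_comm q A : adapted q A -> delta_mx 0 1 *m A = q *: (A *m delta_mx 0 1).
Proof.
move=> [A10 A12 A20 A11]; apply/matrixP; elim/ord3_ind; elim/ord3_ind;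
  rewrite !(mulmx3, mxE) /= ?A10 ?A12 ?A20 ?A11; ring.
Qed.

Lemma adapted_Ad q A : A \in unitmx -> adapted q A -> q *: Ad A (E12 K) = E12 K.
Proof. by move=> Au /adapted_comm aA; rewrite /Ad scalemxAl -aA mulmxK. Qed.

Lemma adaptedD q A B : adapted q A -> adapted q B -> adapted q (A + B).
Proof.
move=> [A10 A12 A20 A11] [B10 B12 B20 B11].
by split; rewrite !mxE ?A10 ?A12 ?A20 ?A11 ?B10 ?B12 ?B20 ?B11 ?addr0 ?mulrDr.
Qed.

Lemma adaptedZ q c A : adapted q A -> adapted q (c *: A).
Proof.
move=> [A10 A12 A20 A11].
by split; rewrite !mxE ?A10 ?A12 ?A20 ?A11 ?mulr0 1?mulrCA.
Qed.

End Conjugation.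

(** The argument of [tangent_curve], with the constant coefficient in place of the linear one. *)
Lemma zariski_closure_curve (K : closedFieldType) n (X : set ('I_n -> K)) x v w
    (r : {poly K}) : r != 0 ->
  (forall s, r.[s] != 0 -> zariski_closure X (fun i => x i + s * v i + s ^+ 2 * w i)) ->
  zariski_closure X x.
Proof.
move=> r0 rX f fX; have [q [qE <- _]] := dirderiv_curve v w x f.
suff -> : q = 0 by rewrite coef0.
by apply: (poly_eq0_closed r0) => s rs; rewrite qE; apply: rX.
Qed.

Section PhiN.
Variables (K : closedFieldType) (p : nat).
Local Notation q := (p%:R : K).
Hypothesis q0 : q != 0.
Implicit Types (g h A B N Phi : 'M[K]_3).

Lemma subregular_adapted g A c : g \in unitmx -> A \in unitmx -> c != 0 ->
  adapted q A -> subregular_locus p (Ad g A, c *: Ad g (E12 K)).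
Proof.
move=> gu Au c0 aA; split=> /=.
  split; first by rewrite /= Ad_unitmx.
  by rewrite /= -AdZ Ad_Ad // -AdZ [Ad A _]AdZ scalerA mulrC -scalerA adapted_Ad.
(* Conjugation by [diag(c, 1, 1)] multiplies [E12] by [c]. *)
pose d : 'rV[K]_3 := \row_i (if i == 0 then c else 1).
have du : diag_mx d \in unitmx.
  rewrite unitmxE det_diag unitfE; apply/prodf_neq0 => i _.
  by rewrite mxE; case: ifP => // _; exact: oner_neq0.
exists (g *m diag_mx d); first by rewrite unitmx_mul gu.
rewrite AdM // -AdZ; congr Ad; apply: (canRL (mulmxK du)).
by apply/matrixP; elim/ord3_ind; elim/ord3_ind; rewrite !(mulmx3, mxE) /=; ring.
Qed.

Local Notation Z := (coords @` subregular_locus p : set ('I_(3 * 3 + 3 * 3) -> K)).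

(** Points with [c = 0] are reached as limits: moving [c] to [c + s] gives a line that is subregular
    wherever ['X + c%:P] is nonzero. *)
Lemma closure_adapted g A c : g \in unitmx -> A \in unitmx -> adapted q A ->
  zariski_closure Z (coords (Ad g A, c *: Ad g (E12 K))).
Proof.
move=> gu Au aA.
apply: (@zariski_closure_curve _ _ _ _ (coords (0, Ad g (E12 K))) (coords (0, 0)) ('X + c%:P)).
  by rewrite -size_poly_eq0 size_XaddC.
move=> s; rewrite hornerD hornerX hornerC => sc f; apply.
exists (Ad g A, (c + s) *: Ad g (E12 K)).
  by apply: subregular_adapted => //; rewrite addrC.
by rewrite -coords_curve !scaler0 !addr0 scalerDl.
Qed.

Lemma X_sub_adapted g A c : g \in unitmx -> A \in unitmx -> adapted q A ->
  X_sub p (Ad g A, c *: Ad g (E12 K)).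
Proof.
move=> gu Au aA; split; last exact: closure_adapted.
split; first by rewrite /= Ad_unitmx.
by rewrite /= -AdZ Ad_Ad // -AdZ [Ad A _]AdZ scalerA mulrC -scalerA adapted_Ad.
Qed.

Local Notation X := (coords @` X_sub p : set ('I_(3 * 3 + 3 * 3) -> K)).

Lemma X_adapted g A c : g \in unitmx -> A \in unitmx -> adapted q A ->
  X (coords (Ad g A, c *: Ad g (E12 K))).
Proof. by move=> gu Au aA; exists (Ad g A, c *: Ad g (E12 K)); first exact: X_sub_adapted. Qed.

Lemma tangent_nilpotent g A : g \in unitmx -> A \in unitmx -> adapted q A ->
  tangent X (coords (Ad g A, 0)) (coords (0, Ad g (E12 K))).
Proof.
move=> gu Au aA; apply: (@tangent_curve _ _ _ _ _ (coords (0, 0)) 1) => [|s _ f].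
  exact: oner_neq0.
apply; rewrite -coords_curve !scaler0 !addr0 add0r; exact: X_adapted.
Qed.

(** Adapted matrices form a linear space, so the line [A + s B] keeps the flag; its determinant [r]
    is a nonzero polynomial because [A] is invertible. *)
Lemma tangent_adapted g A B : g \in unitmx -> A \in unitmx -> adapted q A ->
  adapted q B -> tangent X (coords (Ad g A, 0)) (coords (Ad g B, 0)).
Proof.
move=> gu Au aA aB.
pose r := \det (map_mx polyC A + 'X *: map_mx polyC B).
have rE s : r.[s] = \det (A + s *: B).
  rewrite -horner_evalE -det_map_mx; congr (\det _); apply/matrixP => i j.
  by rewrite !mxE /= horner_evalE !hornerE.
apply: (@tangent_curve _ _ _ _ _ (coords (0, 0)) r) => [|s].
  apply: contraTneq Au => r0; rewrite unitmxE unitfE negbK.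
  by rewrite -[A]addr0 -[X in A + X](scale0r B) -rE r0 horner0.
rewrite rE -unitfE -unitmxE => ABu f; apply.
rewrite -coords_curve !scaler0 !addr0 -AdZ -AdD -[X in (_, X)](scale0r (Ad g (E12 K))).
by apply: X_adapted => //; apply: adaptedD => //; apply: adaptedZ.
Qed.

(** Here the flag moves: since [B B = 0], the inverse of [1 + s B] is [1 - s B], and conjugating [A]
    gives a quadratic curve with the commutator as linear term. *)
Lemma tangent_commutator g A B : g \in unitmx -> A \in unitmx -> adapted q A ->
  B *m B = 0 -> tangent X (coords (Ad g A, 0)) (coords (Ad g (B *m A - A *m B), 0)).
Proof.
move=> gu Au aA BB.
apply: (@tangent_curve _ _ _ _ _ (coords (- Ad g (B *m A *m B), 0)) 1) => [|s _ f].
  exact: oner_neq0.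
apply; rewrite -coords_curve scaler0 addr0.
have BK : (1 + s *: B) *m (1 - s *: B) = 1.
  rewrite mulmxDl mul1mx mulmxBr mulmx1 -!(scalemxAl, scalemxAr) BB !scaler0 subr0.
  by rewrite subrK.
have [Bu _] := mulmx1_unit BK.
have BV : invmx (1 + s *: B) = 1 - s *: B.
  by apply: (can_inj (mulKmx Bu)); rewrite mulmxV ?BK.
have <- : Ad g (Ad (1 + s *: B) A) =
    Ad g A + s *: Ad g (B *m A - A *m B) + s ^+ 2 *: - Ad g (B *m A *m B).
  rewrite scalerN -scaleNr -!AdZ -!AdD; congr Ad.
  rewrite /Ad BV mulmxDl mul1mx mulmxBr mulmx1 mulmxDl -!(scalemxAl, scalemxAr).
  by rewrite scalerA -expr2 scaleNr scalerBr opprD !addrA.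
rewrite -AdM // -[X in (_, X)](scale0r (Ad (g *m (1 + s *: B)) (E12 K))).
by apply: X_adapted => //; rewrite unitmx_mul gu.
Qed.
End PhiN.

(** * Charts on the subregular locus and the dimension bound *)

Section Dimension.
Variables (K : closedFieldType) (p : nat).
Local Notation q := (p%:R : K).
Hypothesis q0 : q != 0.
Local Notation X := (coords @` X_sub p : set ('I_(3 * 3 + 3 * 3) -> K)).

Definition chart_coords (s : 'S_3) : (3 * 3 + 3 * 3).-tuple {mpoly K[9]} :=
  let: c := chart q%:MP (fun i => 'X_i) in
  [tuple row_mx (mxvec (conj_perm s c.1)) (mxvec (conj_perm s c.2)) 0 k | k < _].

Lemma chart_coordsE s w k : (tnth (chart_coords s) k).@[w] =
  coords (conj_perm s (chart q w).1, conj_perm s (chart q w).2) k.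
Proof.
have E : (map_mx (meval w) (chart q%:MP (fun i => 'X_i)).1,
    map_mx (meval w) (chart q%:MP (fun i => 'X_i)).2) = chart q w.
  by rewrite map_chart /= mevalC; congr chart; apply/funext => i /=; exact: mevalXU.
rewrite tnth_mktuple /coords -E /=.
have conjE A : conj_perm s (map_mx (meval w) A) = map_mx (meval w) (conj_perm s A).
  by apply/matrixP => i j; rewrite !mxE.
by rewrite !conjE -!map_mxvec -map_row_mx [RHS]mxE.
Qed.

Lemma subregular_chart Phi N : subregular_locus p (Phi, N) ->
  exists s w, (Phi, N) = (conj_perm s (chart q w).1, conj_perm s (chart q w).2).
Proof.
move=> [[/= Phiu NPhi] [g gu /= NE]].
have gg : invmx g *m g = 1 by exact: mulVmx.
(* [g E12 g^-1] is column 0 of [g] times row 1 of [g^-1]; their pairing is an off-diagonal entry of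
   [g^-1 g], hence zero. *)
apply: (@rank_one_chart _ q q0 N Phi (fun i => g i 0) (fun j => invmx g 1 j)).
- move=> i j; rewrite NE /Ad /E12 !mulmx3 !mxE /=.
  by case: i => [[|[|[|?]]] ?] //=; rewrite ?mulr0 ?mulr1; ring.
- apply: contrapT => H; have := congr1 (fun A : 'M_3 => A 0 0) gg.
  rewrite /= mxE big1 => [|i _]; first by rewrite mxE => /eqP; rewrite eq_sym oner_eq0.
  suff /eqP-> : g i 0 == 0 by rewrite mulr0.
  by apply: contraT => gi; case: H; exists i.
- apply: contrapT => H; have := congr1 (fun A : 'M_3 => A 1 1) gg.
  rewrite /= mxE big1 => [|i _]; first by rewrite mxE => /eqP; rewrite eq_sym oner_eq0.
  suff /eqP-> : invmx g 1 i == 0 by rewrite mul0r.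
  by apply: contraT => gi; case: H; exists i.
- by have := congr1 (fun A : 'M_3 => A 1 0) gg; rewrite /= !mxE.
- rewrite {1}NPhi -scalemxAl /Ad; congr (_ *: _).
  by rewrite mulmxKV.
Qed.

(** A polynomial whose pullbacks along the six permuted charts vanish is zero on the subregular
    locus, hence on its closure. *)
Lemma X_sub_krull_dim x (Xx : X x) d : krull_dim (local_ring Xx) d -> (d <= 9)%N.
Proof.
apply: (@krull_dim_parametrised K _ 9 d X x Xx 'S_3 chart_coords).
move=> f f0 _ [z [_ zZ] <-]; apply: zZ => _ [[Phi N] /subregular_chart[s [w ->]] <-].
have := congr1 (meval w) (f0 s); rewrite meval0 comp_mpoly_meval => E.
by rewrite -[RHS]E; apply: meval_eq => k; rewrite chart_coordsE.
Qed.

End Dimension.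

(** Every linear functional on matrices is a trace pairing with some matrix [C]. *)
Lemma span_matrices (K : fieldType) (L : seq 'M[K]_3) :
  (forall C, (forall U, U \in L -> \tr (C *m U) = 0) -> C = 0) ->
  forall W, exists b : 'I_(size L) -> K, W = \sum_i b i *: L`_i.
Proof.
move=> ann W.
have [|b bW] := @span_of_annihilator K _ ('I_3 * 'I_3)%type
    (fun (i : 'I_(size L)) jk => (L`_i : 'M_3) jk.1 jk.2) _ (fun jk => W jk.1 jk.2).
  move=> c c0 [j k]; pose C : 'M[K]_3 := \matrix_(k, j) c (j, k).
  have -> : c (j, k) = C k j by rewrite mxE.
  suff -> : C = 0 by rewrite mxE.
  apply: ann => U /(nthP 0)[i iL <-]; rewrite -[RHS](c0 (Ordinal iL)) /=.
  have -> A : \tr (C *m A) = \sum_l \sum_m C l m * A m l by apply: eq_bigr => l _; rewrite mxE.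
  by rewrite exchange_big pair_bigA; apply: eq_bigr => -[l m] _; rewrite /= mxE.
exists b; apply/matrixP => j k; rewrite (bW (j, k)) /= summxE.
by apply: eq_bigr => i _; rewrite mxE.
Qed.

(** * Tangent vectors at a point with two flags *)

Section Annihilator.
Variables (K : fieldType) (q : K).
Hypotheses (q0 : q != 0) (q2 : q ^+ 2 != 1).

Lemma mulf0l (x y : K) : x != 0 -> x * y = 0 -> y = 0.
Proof. by move=> x0 /eqP; rewrite mulf_eq0 (negPf x0) => /eqP. Qed.

Lemma eq0_multiple (s t k x : K) : s = t -> x = k * (s - t) -> x = 0.
Proof. by move=> -> ->; rewrite subrr mulr0. Qed.

(* The scalars are the entries of Phi = [a alpha beta; 0 qa 0; 0 gamma x], of a matrix
   C = [qc V U; 0 -c 0; 0 W 0], and of a second flag, given by the line (l0, l1, l2)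
   and the plane with equation (e0, e1, e2). *)
Lemma flag_annihilator (a alpha beta gamma x c V U W : K)
    (l0 l1 l2 a' e0 e1 e2 : K) :
  a != 0 ->
  ~ [/\ l0 = 0, l1 = 0 & l2 = 0] -> ~ [/\ e0 = 0, e1 = 0 & e2 = 0] ->
  ~ [/\ l1 = 0, l2 = 0, e0 = 0 & e2 = 0] ->
  e0 * l0 + e1 * l1 + e2 * l2 = 0 ->
  a * U = q * c * beta + U * x -> x * W - gamma * c = W * (q * a) ->
  a * V - alpha * c + beta * W = q * c * alpha + V * (q * a) + U * gamma ->
  a * l0 + alpha * l1 + beta * l2 = a' * l0 -> q * a * l1 = a' * l1 ->
  gamma * l1 + x * l2 = a' * l2 ->
  e0 * a = q * a' * e0 -> e0 * alpha + e1 * (q * a) + e2 * gamma = q * a' * e1 ->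
  e0 * beta + e2 * x = q * a' * e2 ->
  q * c * l0 + V * l1 + U * l2 = q * c * l0 -> - c * l1 = q * c * l1 ->
  W * l1 = q * c * l2 -> e0 * (q * c) = - c * e0 ->
  e0 * V - e1 * c + e2 * W = - c * e1 -> e0 * U = - c * e2 ->
  [/\ c = 0, V = 0, U = 0 & W = 0].
Proof.
move=> a0 nl ne nle el CU CW CV A0 A1 A2 E0 E1 E2 C0 C1 C2 D0 D1 D2.
have q1 : 1 - q != 0.
  by rewrite subr_eq0; apply: contra q2 => /eqP <-; rewrite expr1n.
have qp1 : 1 + q != 0.
  by rewrite addrC addr_eq0; apply: contra q2 => /eqP ->; rewrite sqrrN expr1n.
have q21 : 1 - q ^+ 2 != 0 by rewrite subr_eq0 eq_sym.
(* Each of [c], [U], [W] being nonzero would make the second flag equal to the standard one, which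
   [nle] forbids. For [c] this follows from the invariance of that flag under [C] alone. *)
have c0 : c = 0.
  apply: contrapT => /eqP c0; apply: nle.
  have l10 : l1 = 0.
    by apply: (mulf0l (mulf_neq0 c0 qp1)); apply: (eq0_multiple (k := -1) C1); ring.
  have l20 : l2 = 0 by apply: (mulf0l (mulf_neq0 q0 c0)); rewrite -C2 l10 mulr0.
  have e00 : e0 = 0.
    by apply: (mulf0l (mulf_neq0 c0 qp1)); apply: (eq0_multiple (k := 1) D0); ring.
  have e20 : e2 = 0.
    by apply: (mulf0l c0); apply: (eq0_multiple (k := 1) D2); rewrite e00; ring.
  by [].
subst c; have {}C0 : V * l1 + U * l2 = 0 by apply: (eq0_multiple (k := 1) C0); ring.
have {C1 D0} D1' : e0 * V + e2 * W = 0 by apply: (eq0_multiple (k := 1) D1); ring.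
have {}C2 : W * l1 = 0 by rewrite C2; ring.
have {}D2 : e0 * U = 0 by rewrite D2; ring.
(* [U != 0] forces [x = a]. The line of the second flag then cannot have eigenvalue [q a]: the
   quotient by the plane would have eigenvalue [q^2 a], which differs from both [a] and [q a]. *)
have U0 : U = 0.
  apply: contrapT => /eqP U0; apply: nle.
  have xa : x = a.
    apply/eqP; rewrite -subr_eq0; apply/eqP; apply: (mulf0l U0).
    by apply: (eq0_multiple (k := -1) CU); ring.
  have e00 : e0 = 0 by apply: (mulf0l U0); rewrite mulrC.
  subst x e0; have l10 : l1 = 0.
    apply: contrapT => /eqP l10; apply: ne.
    have a'E : a' = q * a by apply: (mulIf l10).
    have e20 : e2 = 0.
      apply: (mulf0l (mulf_neq0 a0 q21)); apply: (eq0_multiple (k := 1) E2).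
      by rewrite a'E; ring.
    split=> //; apply: (mulf0l (mulf_neq0 (mulf_neq0 q0 a0) q1)).
    by apply: (eq0_multiple (k := 1) E1); rewrite a'E e20; ring.
  subst l1; have l20 : l2 = 0 by apply: (mulf0l U0); rewrite -C0; ring.
  subst l2; have l00 : l0 != 0 by apply/eqP => l00; apply: nl.
  have a'E : a' = a.
    by apply: (mulIf l00); apply/esym; rewrite -A0; ring.
  split=> //; apply: (mulf0l (mulf_neq0 a0 q1)).
  by apply: (eq0_multiple (k := 1) E2); rewrite a'E; ring.
(* Similarly [W != 0] forces [x = q a], and again [a] is the only possible eigenvalue on the
   line. *)
subst U; have W0 : W = 0.
  apply: contrapT => /eqP W0; apply: nle.
  have xa : x = q * a.
    apply/eqP; rewrite -subr_eq0; apply/eqP; apply: (mulf0l W0).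
    by apply: (eq0_multiple (k := 1) CW); ring.
  have l10 : l1 = 0 by exact: (mulf0l W0).
  subst x l1; have l20 : l2 = 0.
    apply: contrapT => /eqP l20; apply: ne.
    have a'E : a' = q * a by apply: (mulIf l20); rewrite -A2; ring.
    have e00 : e0 = 0.
      apply: (mulf0l (mulf_neq0 a0 q21)); apply: (eq0_multiple (k := 1) E0).
      by rewrite a'E; ring.
    have e20 : e2 = 0 by apply: (mulf0l W0); rewrite -D1' e00; ring.
    split=> //; apply: (mulf0l (mulf_neq0 (mulf_neq0 q0 a0) q1)).
    by apply: (eq0_multiple (k := 1) E1); rewrite a'E e00 e20; ring.
  subst l2; have l00 : l0 != 0 by apply/eqP => l00; apply: nl.
  have a'E : a' = a by apply: (mulIf l00); apply/esym; rewrite -A0; ring.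
  have e00 : e0 = 0.
    apply: (mulf0l (mulf_neq0 a0 q1)); apply: (eq0_multiple (k := 1) E0).
    by rewrite a'E; ring.
  by split=> //; apply: (mulf0l W0); rewrite -D1' e00; ring.
split=> //; subst W; apply: (mulf0l (mulf_neq0 a0 q1)).
by apply: (eq0_multiple (k := 1) CV); ring.
Qed.
End Annihilator.

Section TwoFlags.
Variables (K : fieldType) (q : K).
Hypotheses (q0 : q != 0) (q2 : q ^+ 2 != 1).
Implicit Types (A B C h : 'M[K]_3).

Definition adapted_basis : seq 'M[K]_3 :=
  [:: delta_mx 0 0 + q *: delta_mx 1 1; delta_mx 2 2; delta_mx 0 1; delta_mx 0 2;
      delta_mx 2 1].

Lemma adapted_basisP : {in adapted_basis, forall B, adapted q B}.
Proof.
move=> B; rewrite !inE.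
by case/or4P => [/eqP->|/eqP->|/eqP->|/orP[]/eqP->]; split;
  rewrite !mxE /=; ring.
Qed.

Lemma adapted_annihilator C : {in adapted_basis, forall B, \tr (C *m B) = 0} ->
  [/\ C 0 0 = - q * C 1 1, C 2 2 = 0, C 1 0 = 0, C 2 0 = 0 & C 1 2 = 0].
Proof.
move=> annC; split.
- have := annC _ (mem_head _ _); rewrite mulmxDr -scalemxAr mxtraceD mxtraceZ.
  by rewrite !mxtrace_mul_delta mulNr => /eqP; rewrite addr_eq0 => /eqP.
- by rewrite -(mxtrace_mul_delta C 2 2); apply: annC; rewrite !inE eqxx ?orbT.
- by rewrite -(mxtrace_mul_delta C 0 1); apply: annC; rewrite !inE eqxx ?orbT.
- by rewrite -(mxtrace_mul_delta C 0 2); apply: annC; rewrite !inE eqxx ?orbT.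
- by rewrite -(mxtrace_mul_delta C 2 1); apply: annC; rewrite !inE eqxx ?orbT.
Qed.

(** [\tr (C [D, A]) = \tr ([A, C] D)], and pairing with an elementary matrix reads off one entry. *)
Lemma commutator_annihilator A C i j :
  \tr (C *m (delta_mx i j *m A - A *m delta_mx i j)) = 0 -> (A *m C) j i = (C *m A) j i.
Proof.
rewrite mulmxBr raddfB /= !mulmxA mxtrace_mulC !mulmxA !mxtrace_mul_delta.
by move=> /eqP; rewrite subr_eq0 => /eqP.
Qed.

Lemma mxtrace_Ad h C B : \tr (C *m Ad h B) = \tr (Ad (invmx h) C *m B).
Proof. by rewrite /Ad invmxK !mulmxA mxtrace_mulC !mulmxA. Qed.

Lemma eq_of_sub (s t x y : K) : s = t -> x - y = s - t -> x = y.
Proof. by move=> ->; rewrite subrr => /eqP; rewrite subr_eq0 => /eqP. Qed.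

(** The three families give, in turn, the shape of [C], the same shape for its conjugate [C'], and
    three entries of [A C = C A]. With column 0 of [h] as line and row 1 of [invmx h] as equation of
    the plane, these yield the equations of [flag_annihilator]; [~ P_sub h] says that the two flags
    differ. *)
Lemma two_flags_annihilator A A' C h : h \in unitmx -> A \in unitmx ->
  adapted q A -> adapted q A' -> A = Ad h A' -> ~ P_sub h ->
  {in adapted_basis, forall B, \tr (C *m B) = 0} ->
  {in adapted_basis, forall B, \tr (C *m Ad h B) = 0} ->
  {in [:: delta_mx 1 0; delta_mx 1 2; delta_mx 2 0],
    forall D, \tr (C *m (D *m A - A *m D)) = 0} ->
  C = 0.
Proof.
move=> hu Au aA aA' AE nP annC annC' comC.
pose C' := Ad (invmx h) C.
have CE : C = Ad h C' by rewrite /C' AdVK.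
have {annC'} [] : [/\ C' 0 0 = - q * C' 1 1, C' 2 2 = 0, C' 1 0 = 0, C' 2 0 = 0 & C' 1 2 = 0].
  by apply: adapted_annihilator => B /annC'; rewrite mxtrace_Ad.
move: C' CE => C' CE C'00 C'22 C'10 C'20 C'12.
have [C00 C22 C10 C20 C12] := adapted_annihilator annC.
have [A10 A12 A20 A11] := aA; have [A'10 A'12 A'20 A'11] := aA'.
(* [C] and [C'] have the same trace, which is [1 - q] times this entry. *)
have C11 : C' 1 1 = C 1 1.
  have trC : \tr C = \tr C' by rewrite CE /Ad mxtrace_mulC mulKmx.
  have q1 : 1 - q != 0.
    by rewrite subr_eq0; apply: contra q2 => /eqP <-; rewrite expr1n.
  apply: (mulfI q1); apply: (eq_of_sub (esym trC)).
  by rewrite /mxtrace !sum_ord3 C'00 C'22 C00 C22; ring.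
have hV : invmx h *m h = 1 by exact: mulVmx.
have Ah : A *m h = h *m A' by rewrite AE /Ad mulmxKV.
have hA : invmx h *m A = A' *m invmx h by rewrite AE /Ad !mulmxA mulVmx // mul1mx.
have Ch : C *m h = h *m C' by rewrite CE /Ad mulmxKV.
have hC : invmx h *m C = C' *m invmx h by rewrite CE /Ad !mulmxA mulVmx // mul1mx.
have hV00 := congr1 (fun B : 'M[K]_3 => B 0 0) hV.
have hV10 := congr1 (fun B : 'M[K]_3 => B 1 0) hV.
have hV11 := congr1 (fun B : 'M[K]_3 => B 1 1) hV.
have hV12 := congr1 (fun B : 'M[K]_3 => B 1 2) hV.
move: hV00 hV10 hV11 hV12; rewrite /= !mulmx3 !mxE /= => hV00 hV10 hV11 hV12.
have a0 : A 0 0 != 0.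
  apply/eqP => A00; have := congr1 (fun B : 'M[K]_3 => B 0 0) (mulVmx Au).
  by rewrite /= mulmx3 A00 A10 A20 !mulr0 !addr0 mxE => /eqP; rewrite eq_sym oner_eq0.
have col i := congr1 (fun B : 'M[K]_3 => B i 0) Ah.
have row j := congr1 (fun B : 'M[K]_3 => B 1 j) hA.
have colC i := congr1 (fun B : 'M[K]_3 => B i 0) Ch.
have rowC j := congr1 (fun B : 'M[K]_3 => B 1 j) hC.
have com i j : (delta_mx j i : 'M[K]_3) \in [:: delta_mx 1 0; delta_mx 1 2; delta_mx 2 0] ->
    (A *m C) i j = (C *m A) i j.
  by move=> D0; apply: commutator_annihilator; apply: comC.
have H := @flag_annihilator K q q0 q2 (A 0 0) (A 0 1) (A 0 2) (A 2 1) (A 2 2)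
  (- C 1 1) (C 0 1) (C 0 2) (C 2 1) (h 0 0) (h 1 0) (h 2 0) (A' 0 0)
  (invmx h 1 0) (invmx h 1 1) (invmx h 1 2) a0.
have {H} [] : [/\ - C 1 1 = 0, C 0 1 = 0, C 0 2 = 0 & C 2 1 = 0].
  apply: H.
  - move=> [h0 h1 h2]; move: hV00; rewrite h0 h1 h2 !mulr0 !addr0 => /eqP.
    by rewrite eq_sym oner_eq0.
  - move=> [h0 h1 h2]; move: hV11; rewrite h0 h1 h2 !mul0r !addr0 => /eqP.
    by rewrite eq_sym oner_eq0.
  - move=> [h1 h2 e0 e2]; apply: nP; split=> //.
    move: hV11 hV12; rewrite e0 e2 !mul0r !addr0 !add0r => e1 /eqP.
    rewrite mulf_eq0 => /orP[/eqP e|/eqP//].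
    by move/eqP: e1; rewrite e mul0r eq_sym oner_eq0.
  - exact: hV10.
  - apply: (eq_of_sub (com 0 2 _)); first by rewrite !inE eqxx ?orbT.
    by rewrite !mulmx3 C00 C22 C12 A12; ring.
  - apply: (eq_of_sub (com 2 1 _)); first by rewrite !inE eqxx ?orbT.
    by rewrite !mulmx3 A20 A11 C20 C22; ring.
  - apply: (eq_of_sub (com 0 1 _)); first by rewrite !inE eqxx ?orbT.
    by rewrite !mulmx3 C00 A11; ring.
  - by apply: (eq_of_sub (col 0)); rewrite !mulmx3 A'10 A'20; ring.
  - by apply: (eq_of_sub (col 1)); rewrite !mulmx3 A10 A11 A12 A'10 A'20; ring.
  - by apply: (eq_of_sub (col 2)); rewrite !mulmx3 A20 A'10 A'20; ring.
  - by apply: (eq_of_sub (row 0)); rewrite !mulmx3 A10 A20 A'10 A'12 A'11; ring.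
  - by apply: (eq_of_sub (row 1)); rewrite !mulmx3 A11 A'10 A'12 A'11; ring.
  - by apply: (eq_of_sub (row 2)); rewrite !mulmx3 A12 A'10 A'12 A'11; ring.
  - by apply: (eq_of_sub (colC 0)); rewrite !mulmx3 C00 C'10 C'20 C'00 C11; ring.
  - by apply: (eq_of_sub (colC 1)); rewrite !mulmx3 C10 C12 C'10 C'20 C'00 C11; ring.
  - by apply: (eq_of_sub (colC 2)); rewrite !mulmx3 C20 C22 C'10 C'20 C'00 C11; ring.
  - by apply: (eq_of_sub (rowC 0)); rewrite !mulmx3 C00 C10 C20 C'10 C'12 C11; ring.
  - by apply: (eq_of_sub (rowC 1)); rewrite !mulmx3 C'10 C'12 C11; ring.
  - by apply: (eq_of_sub (rowC 2)); rewrite !mulmx3 C12 C22 C'10 C'12 C11; ring.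
move=> /eqP; rewrite oppr_eq0 => /eqP C110 C01 C02 C21.
apply/matrixP; elim/ord3_ind; elim/ord3_ind; rewrite [RHS]mxE //.
by rewrite C00 C110 mulr0.
Qed.

End TwoFlags.

(** * Ten tangent directions and the failure of regularity *)

Section TangentSpace.
Variables (K : closedFieldType) (p : nat).
Local Notation q := (p%:R : K).
Hypotheses (q0 : q != 0) (q2 : q ^+ 2 != 1).
Local Notation X := (coords @` X_sub p : set ('I_(3 * 3 + 3 * 3) -> K)).

(** [L] collects tangent directions of three kinds: deforming along the first flag, deforming along
    the second (as [Ad g A = Ad (g h) A']), and moving the first flag by the three elementary
    nilpotents outside [P_sub]. Their common annihilator under the trace form is zero. *)
Lemma tangent_two_flags (A A' g h W : 'M[K]_3) :
  g \in unitmx -> h \in unitmx -> A \in unitmx -> A' \in unitmx ->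
  adapted q A -> adapted q A' -> A = Ad h A' -> ~ P_sub h ->
  tangent X (coords (Ad g A, 0)) (coords (W, 0)).
Proof.
move=> gu hu Au Au' aA aA' AE nP.
pose N : seq 'M[K]_3 := [:: delta_mx 1 0; delta_mx 1 2; delta_mx 2 0].
pose L := adapted_basis q ++ [seq Ad h B | B <- adapted_basis q] ++
  [seq D *m A - A *m D | D <- N].
have tanL B : B \in L -> tangent X (coords (Ad g A, 0)) (coords (Ad g B, 0)).
  rewrite !mem_cat => /or3P[|/mapP[D]|/mapP[D]].
  - by move=> /adapted_basisP; apply: tangent_adapted.
  - move=> /adapted_basisP aD ->; rewrite AE -!AdM //.
    by apply: tangent_adapted => //; rewrite unitmx_mul gu.
  - move=> DN ->; apply: tangent_commutator => //.
    by move: DN; rewrite !inE => /or3P[]/eqP->; rewrite mul_delta_mx_0.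
have [|b bW] := span_matrices (L := L) _ (Ad (invmx g) W).
  move=> C annC; apply: (two_flags_annihilator q0 q2 hu Au aA aA' AE nP) => B BL;
    apply: annC; rewrite !mem_cat.
  - by rewrite BL.
  - by rewrite map_f ?orbT.
  - by rewrite (map_f (fun D => D *m A - A *m D)) ?orbT.
have -> : coords (W, 0) = fun k => \sum_i b i * coords (Ad g L`_i, 0) k.
  apply/funext => k; rewrite -coords_sum; congr coords.
  rewrite -[W in LHS](AdVK _ gu) bW.
  apply: injective_projections => /=.
    rewrite [RHS](big_morph fst (fun _ _ => erefl) erefl) /=.
    rewrite (big_morph (Ad g) (AdD g) (_ : _ = 0)); last by rewrite /Ad mulmx0 mul0mx.
    by apply: eq_bigr => i _; rewrite AdZ.
  rewrite [RHS](big_morph snd (fun _ _ => erefl) erefl) /=.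
  by rewrite big1 // => i _; rewrite scaler0.
by apply: tangent_sum => i; apply: tanL; apply: mem_nth.
Qed.

(** The nine directions [(delta_mx i j, 0)] and one nilpotent direction force any generating family
    of the maximal ideal to have ten members, whereas regularity would provide one whose size is the
    dimension, at most nine. *)
Lemma singular_two_flags (A A' g h : 'M[K]_3) :
  g \in unitmx -> h \in unitmx -> A \in unitmx -> A' \in unitmx ->
  adapted q A -> adapted q A' -> A = Ad h A' -> ~ P_sub h ->
  singular_at X (coords (Ad g A, 0)).
Proof.
move=> gu hu Au Au' aA aA' AE nP.
have Xx : X (coords (Ad g A, 0)).
  by rewrite -[X in (_, X)](scale0r (Ad g (E12 K))); apply: X_adapted.
exists Xx => -[_ [m [maxm _ [s gens dims]]]].
have := leq_trans _ (X_sub_krull_dim q0 dims); move=> /(_ 10%N) H.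
suff /H : (10 <= size s)%N by [].
pose u (i : option ('I_3 * 'I_3)) : 'M[K]_3 * 'M[K]_3 :=
  if i is Some ij then (delta_mx ij.1 ij.2, 0) else (0, Ad g (E12 K)).
have <- : #|{: option ('I_3 * 'I_3)}| = 10%N by rewrite card_option card_prod !card_ord.
apply: (@tangent_family_le K _ X _ Xx m s _ (fun i => coords (u i)) maxm gens).
  by case=> [[i j]|] /=; [apply: (tangent_two_flags _ gu hu Au Au') | apply: tangent_nilpotent].
move=> b bu; have : \sum_i b i *: u i = 0.
  by apply: coords_eq0 => k; rewrite coords_sum.
move=> bu0 l.
have bu1 : \sum_i b i *: (u i).1 = 0.
  by have := congr1 fst bu0; rewrite (big_morph fst (fun _ _ => erefl) erefl).
have bu2 : \sum_i b i *: (u i).2 = 0.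
  by have := congr1 snd bu0; rewrite (big_morph snd (fun _ _ => erefl) erefl).
case: l => [[i j]|].
  have := congr1 (fun B : 'M[K]_3 => B i j) bu1.
  rewrite /= summxE (bigD1 (Some (i, j))) //= big1 => [|[[k l]|] //= kl].
  - by rewrite addr0 !mxE !eqxx mulr1.
  - rewrite !mxE; case: eqP => [ik|]; case: eqP => [jl|]; rewrite ?mulr0 //.
    by case/eqP: kl; rewrite ik jl.
  - by rewrite !mxE mulr0.
move: bu2; rewrite (bigD1 None) //= big1 => [|[kl|] //= _]; last exact: scaler0.
move=> /eqP; rewrite addr0 scaler_eq0 => /orP[/eqP//|/eqP E0].
have /matrixP/(_ 0 1) : E12 K = 0 by rewrite -(AdK (E12 K) gu) E0 /Ad mulmx0 mul0mx.
by rewrite !mxE => /eqP; rewrite oner_eq0.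
Qed.

(** The vanishing of [1 - p Ad(Phi)] on [p2 P], applied to [Ad g E12], supplies the eigenvalue
    condition: at entry [(0, 1)] it reads [A 1 1 = q * A 0 0]. *)
Lemma Xt_sub_adapted (P : set 'M[K]_3) Phi : Xt_sub p (P, Phi, 0) ->
  exists g A, [/\ g \in unitmx, A \in unitmx, adapted q A, Phi = Ad g A &
    P = Ad g @` @P_sub K].
Proof.
move=> [[g gu PE]]; rewrite {1}PE => -[A [Au A10 A12 A20] AE] _ killp2.
exists g, A; split=> //; split=> //.
have /killp2 : p2 P (Ad g (E12 K)).
  by exists g; split=> //; exists (E12 K) => //; exists 1; rewrite scale1r.
rewrite -AE Ad_Ad // -AdZ => /eqP; rewrite subr_eq0.
move=> /eqP/(congr1 (Ad (invmx g))); rewrite !AdK // => E1.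
have /matrixP/(_ 0 1) : E12 K *m A = q *: (A *m E12 K).
  by rewrite {1}E1 -scalemxAl mulmxKV.
by rewrite /E12 !(mulmx3, mxE) /= !(mul0r, mulr0, mul1r, mulr1, add0r, addr0).
Qed.

(** [P_sub] is closed under products and inverses, so [h] normalises it. *)
Lemma P_sub_conj g h : g \in unitmx -> P_sub h ->
  Ad (g *m h) @` @P_sub K = Ad g @` @P_sub K.
Proof.
have mulP (A B : 'M[K]_3) : P_sub A -> P_sub B -> P_sub (A *m B).
  move=> [Au A10 A12 A20] [Bu B10 B12 B20]; split; first by rewrite unitmx_mul Au.
  - by rewrite mulmx3 A10 A12 B10; ring.
  - by rewrite mulmx3 A10 A12 B12; ring.
  - by rewrite mulmx3 A20 B10 B20; ring.
have invP (A : 'M[K]_3) : P_sub A -> P_sub (invmx A).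
  move=> [Au A10 A12 A20].
  have AV i j := congr1 (fun B : 'M[K]_3 => B i j) (mulmxV Au).
  have VA i j := congr1 (fun B : 'M[K]_3 => B i j) (mulVmx Au).
  move: (VA 0 0) (VA 1 0) (VA 2 0) (AV 1 1) (AV 1 0) (AV 1 2) => /=.
  rewrite !mulmx3 !mxE /= A10 A12 A20 !(mul0r, mulr0, add0r, addr0).
  move=> V00 V10 V20 V11 V10' V12.
  have a0 : A 0 0 != 0 by apply/eqP => a0; move/eqP: V00; rewrite a0 mulr0 eq_sym oner_eq0.
  have a1 : A 1 1 != 0 by apply/eqP => a1; move/eqP: V11; rewrite a1 mul0r eq_sym oner_eq0.
  split; first by rewrite unitmx_inv.
  - by apply: (mulIf a0); rewrite V10 mul0r.
  - by apply: (mulfI a1); rewrite V12 mulr0.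
  - by apply: (mulIf a0); rewrite V20 mul0r.
move=> gu hP; have hu : h \in unitmx by case: hP.
apply/seteqP; split=> _ [B BP <-].
  exists (Ad h B); last by rewrite AdM.
  by apply: (mulP); [exact: (mulP) | exact: invP].
exists (Ad (invmx h) B); last by rewrite AdM // AdVK.
by apply: (mulP); [apply: (mulP) => //; exact: invP | rewrite invmxK].
Qed.

End TangentSpace.

(** * The prime [p] as a scalar, and the conclusion *)

(** The absolute values of [p] and of its square are [1/p] and [1/p^2], neither 0 nor 1. *)
Lemma padic_natr_neq0 p (F : fieldType) (abs : F -> rat) :
  prime p -> padic_field p abs -> (p%:R : F) != 0 /\ (p%:R : F) ^+ 2 != 1.
Proof.
move=> p_pr padic; have p0 : (p%:R : rat) != 0 by rewrite pnatr_eq0 -lt0n prime_gt0.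
have absp := padic_abs_p padic; split.
  apply/eqP => /(padic_abs_eq0 padic)/eqP; rewrite absp invr_eq0.
  by rewrite (negPf p0).
apply/eqP => pp1.
have abs1 : abs 1 = 1.
  have a1 : abs 1 != 0.
    by apply/eqP => /(padic_abs_eq0 padic)/eqP; rewrite oner_eq0.
  by apply: (mulIf a1); rewrite -(padic_absM padic) !mul1r.
have := congr1 abs pp1; rewrite expr2 (padic_absM padic) absp abs1 => /eqP.
rewrite -invfM invr_eq1 -natrM pnatr_eq1 => /eqP.
by case: p p_pr {padic absp p0 pp1} => [|[|p]].
Qed.

Theorem theorem7p11 (p : nat) (p_prime : prime p)
    (Qp : fieldType) (absp : Qp -> rat) (Qp_padic : padic_field p absp)
    (E : fieldExtType Qp)
    (Ebar : closedFieldType) (iota : {rmorphism E -> Ebar})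
    (Ebar_alg : forall z : Ebar, algebraicOver iota z)
    (Phi : 'M[Ebar]_3)
    (many_preimages : exists y z : set 'M[Ebar]_3 * 'M[Ebar]_3 * 'M[Ebar]_3,
       [/\ Xt_sub p y, Xt_sub p z, y <> z,
           Xt_sub_proj y = (Phi, 0) & Xt_sub_proj z = (Phi, 0)]) :
  singular_at (coords @` X_sub p) (coords (Phi, 0)).

Proof.
have [q0Qp q2Qp] := padic_natr_neq0 p_prime Qp_padic.
have natE n : (n%:R : Ebar) = iota (in_alg E n%:R) by rewrite !rmorph_nat.
have q0 : (p%:R : Ebar) != 0 by rewrite natE !fmorph_eq0.
have q2 : (p%:R : Ebar) ^+ 2 != 1 by rewrite -natrX natE !fmorph_eq1 natrX.
case: many_preimages => -[[P Phi1] N1] [[[P' Phi2] N2] []].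
rewrite /Xt_sub_proj /= => Xy Xz yz [? ?] [? ?]; subst Phi1 Phi2 N1 N2.
have [g [A [gu Au aA PhiE PE]]] := Xt_sub_adapted Xy.
have [g' [A' [g'u Au' aA' PhiE' PE']]] := Xt_sub_adapted Xz.
(* [h] compares the two flags: were it in [P_sub], the parabolics would coincide, and with them the
   two preimages. *)
pose h := invmx g *m g'.
have hu : h \in unitmx by rewrite unitmx_mul unitmx_inv gu.
have g'E : g' = g *m h by rewrite /h mulmxA mulmxV // mul1mx.
rewrite PhiE; apply: (singular_two_flags q0 q2 gu hu Au Au' aA aA').
  by rewrite -(AdK A gu) -PhiE PhiE' g'E AdM // AdK.
by move=> hP; apply: yz; rewrite PE PE' g'E P_sub_conj.
Qed.
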